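(* Let $(\mathbb{G},\cdot)=(\mathbb{R}^n,\cdot)=(\mathbb{R}^m_x\times\mathbb{R}^\ell_t,\cdot)$ be a two-step Carnot group with group law $$(x,t)\cdot(\xi,\tau)=\Bigl(x+\xi,\ t+\tau+\tfrac12\langle x,A\xi\rangle\Bigr),$$ where $A=(A^1,\dots,A^\ell)$ is a family of skew-symmetric $m\times m$ real matrices satisfying the Hörmander condition, and let $d(x,t)$ denote the subRiemannian distance of $(x,t)$ from the origin. (i) For every point of the form $(x,0)=\gamma(1)$ which is the final point of an abnormal minimizer $\gamma:[0,1]\to\mathbb{G}$ leaving from the origin, there are $C>0$ and $\tau\in\mathbb{R}^\ell$ such that $$d(x,\beta\tau)-d(x,0)\ge C|\beta|\quad\text{for all }\beta\in[-1,1].$$ (ii) If moreover $(\mathbb{G},\cdot)$ is free, then for every point $(x,t)=\gamma(1)$ which is the final point of an abnormal minimizer $\gamma:[0,1]\to\mathbb{G}$ leaving from the origin, there are $C>0$ and $(0,\tau)\in\mathbb{G}$ such that $$d(x,t+\beta\tau)-d(x,t)\ge C|\beta|\quad\text{for all }\beta\in[-1,1].$$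
   Context: Setting. $A^1,\dots,A^\ell\in\mathbb{R}^{m\times m}$ are skew-symmetric matrices, $\langle\cdot,\cdot\rangle$ is the Euclidean inner product, and $\langle x,A\xi\rangle:=(\langle x,A^1\xi\rangle,\dots,\langle x,A^\ell\xi\rangle)\in\mathbb{R}^\ell$. The Hörmander condition is $\operatorname{span}\{(A^1_{jk},\dots,A^\ell_{jk}):1\le j<k\le m\}=\mathbb{R}^\ell$. The horizontal left-invariant vector fields are $X_j=\partial_{x_j}+\frac12\sum_{k=1}^m\sum_{\alpha=1}^\ell A^\alpha_{kj}x_k\,\partial_{t_\alpha}$, $j=1,\dots,m$. The group is free (of step two) if its Lie algebra is the free two-step nilpotent Lie algebra on $X_1,\dots,X_m$, i.e. $\ell=m(m-1)/2$ (up to a linear change of the variable $t$, this is $\mathbb{R}^m\times\wedge^2\mathbb{R}^m$ with law $(x,t)\cdot(\xi,\tau)=(x+\xi,t+\tau+\frac12x\wedge\xi)$). Distance. A horizontal path is a path $\gamma\in W^{1,2}((0,1),\mathbb{R}^n)$ for which there is a control $u\in L^2((0,1),\mathbb{R}^m)$ with $\dot\gamma(s)=\sum_j u_j(s)X_j(\gamma(s))$ for a.e. $s$; its length is $\int_0^1|u(s)|\,ds$. The subRiemannian distance between two points is the infimum of lengths of horizontal paths joining them. A length minimizer is a horizontal path on $[0,1]$ whose length equals the distance between its endpoints. Abnormality. For $u\in L^2((0,1),\mathbb{R}^m)$ let $\gamma_u$ be the horizontal path with control $u$ and $\gamma_u(0)=(0,0)$, and let $E(u)=\gamma_u(1)$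 be the (smooth) endpoint map $E:L^2((0,1),\mathbb{R}^m)\to\mathbb{R}^n$. The control $u$ and the path $\gamma_u$ are abnormal if there is $\xi\in\mathbb{R}^n\setminus\{0\}$ with $\langle\xi,dE(u)v\rangle=0$ for all $v\in L^2((0,1),\mathbb{R}^m)$ (equivalently, $dE(u)$ is not onto). An abnormal minimizer is a length minimizer that is abnormal. *)

(* Defs.v *)
From HB Require Import structures.
From mathcomp Require Import all_boot all_order all_algebra.
From mathcomp Require Import all_classical all_reals all_analysis.

Set Implicit Arguments.
Unset Strict Implicit.
Unset Printing Implicit Defensive.

Import Order.TTheory GRing.Theory Num.Theory.
Import numFieldNormedType.Exports.

Local Open Scope classical_set_scope.
Local Open Scope ring_scope.

(* The norms that MathComp-Analysis puts on row vectors and on pairs are max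
   norms; the Euclidean ones are therefore introduced here. *)
Definition dotp (R : realType) (m : nat) (x y : 'rV[R]_m) : R :=
  \sum_i x 0 i * y 0 i.

Definition enorm (R : realType) (m : nat) (x : 'rV[R]_m) : R :=
  Num.sqrt (dotp x x).

(* The underlying space R^n = R^m_x * R^l_t of the group. *)
Notation carnot R m l := ('rV[R]_m * 'rV[R]_l)%type.

Definition dotG (R : realType) (m l : nat) (p q : carnot R m l) : R :=
  dotp p.1 q.1 + dotp p.2 q.2.

Definition enormG (R : realType) (m l : nat) (p : carnot R m l) : R :=
  Num.sqrt (dotG p p).

Definition skew_family (R : realType) (m l : nat) (A : 'I_l -> 'M[R]_m) :=
  forall a : 'I_l, (A a)^T = - A a.

Definition hormander (R : realType) (m l : nat) (A : 'I_l -> 'M[R]_m) :=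
  <<[seq \row_(a < l) A a jk.1 jk.2
      | jk <- enum [pred jk : 'I_m * 'I_m | (jk.1 < jk.2)%N]]>>%VS
  = fullv :> {vspace 'rV[R]_l}.

(* <x, A xi>; vectors are rows, so that A^a xi is the row xi *m (A a)^T. *)
Definition pairA (R : realType) (m l : nat) (A : 'I_l -> 'M[R]_m)
    (x xi : 'rV[R]_m) : 'rV[R]_l :=
  \row_a dotp x (xi *m (A a)^T).

Definition carnot_mul (R : realType) (m l : nat) (A : 'I_l -> 'M[R]_m)
    (p q : carnot R m l) : carnot R m l :=
  (p.1 + q.1, p.2 + q.2 + 2^-1 *: pairA A p.1 q.1).

Definition Xfield (R : realType) (m l : nat) (A : 'I_l -> 'M[R]_m) (j : 'I_m)
    (p : carnot R m l) : carnot R m l :=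
  (delta_mx 0 j, \row_a (2^-1 * \sum_k A a k j * p.1 0 k)).

(* Xfield A j is the left-invariant vector field equal to d/dx_j at the origin:
   right translations along the x_j-axis are its integral curves. *)
Lemma carnot_mul_Xfield (R : realType) (m l : nat) (A : 'I_l -> 'M[R]_m)
    (j : 'I_m) (p : carnot R m l) (h : R) :
  carnot_mul A p (h *: delta_mx 0 j, 0) = p + h *: Xfield A j p.
Proof.
rewrite /carnot_mul /Xfield /=; congr pair; rewrite addr0; congr (_ + _).
apply/rowP => a; rewrite !mxE mulrCA; congr (_ * _).
rewrite /dotp mulr_sumr; apply: eq_bigr => i _.
rewrite -scalemxAl -rowE !mxE.
by rewrite mulrCA (mulrC (p.1 0 i)).
Qed.

(* The second layer is spanned by the brackets [X_j, X_k] with j < k, so that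
   the Lie algebra is the free two-step nilpotent one on X_1, ..., X_m exactly
   when these m(m-1)/2 brackets form a basis of it. *)
Definition free_step_two (m l : nat) : Prop := l = (m * m.-1)./2%N.

(* Functions on the interval (0, 1) are represented by functions on R whose
   values outside of the interval are irrelevant. *)
Definition L2fun (R : realType) (f : R -> R) : Prop :=
  measurable_fun (`]0, 1[ : set R) f /\
  (\int[lebesgue_measure]_(s in `]0%R, 1%R[) (f s ^+ 2)%:E < +oo)%E.

Definition L2vec (R : realType) (m : nat) (u : R -> 'rV[R]_m) : Prop :=
  forall j, L2fun (fun s => u s 0 j).

Definition L2norm (R : realType) (m : nat) (u : R -> 'rV[R]_m) : R :=
  Num.sqrt (\int[lebesgue_measure]_(s in `]0, 1[) (enorm (u s) ^+ 2)).

(* C^1 functions with compact support in (0, 1). *)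
Definition test_function (R : realType) (phi : R -> R) : Prop :=
  [/\ forall s, derivable phi s 1,
      continuous (derive1 phi),
      compact (closure [set s | phi s != 0])
    & closure [set s | phi s != 0] `<=` `]0, 1[].

Definition weak_derivative (R : realType) (f g : R -> R) : Prop :=
  forall phi, test_function phi ->
    \int[lebesgue_measure]_(s in `]0, 1[) (f s * derive1 phi s)
    = - \int[lebesgue_measure]_(s in `]0, 1[) (g s * phi s).

(* f is the continuous representative on [0, 1] (so that f 0 and f 1 make
   sense) of an element of W^{1,2}((0, 1)) with weak derivative g. *)
Definition W12 (R : realType) (f g : R -> R) : Prop :=
  [/\ {within `[0, 1], continuous f}, L2fun f, L2fun g & weak_derivative f g].

Definition W12path (R : realType) (m l : nat) (gamma dgamma : R -> carnot R m l)
    : Prop :=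
  (forall i, W12 (fun s => (gamma s).1 0 i) (fun s => (dgamma s).1 0 i)) /\
  (forall a, W12 (fun s => (gamma s).2 0 a) (fun s => (dgamma s).2 0 a)).

Definition horizontal (R : realType) (m l : nat) (A : 'I_l -> 'M[R]_m)
    (gamma : R -> carnot R m l) (u : R -> 'rV[R]_m) : Prop :=
  L2vec u /\
  exists2 dgamma : R -> carnot R m l, W12path gamma dgamma &
    {ae lebesgue_measure, forall s : R, 0 < s < 1 ->
      dgamma s = \sum_(j < m) u s 0 j *: Xfield A j (gamma s)}.

(* The X_j are linearly independent at every point, so that the control of a
   horizontal path is determined by the path almost everywhere. *)
Definition path_length (R : realType) (m : nat) (u : R -> 'rV[R]_m) : \bar R :=
  (\int[lebesgue_measure]_(s in `]0%R, 1%R[) (enorm (u s))%:E)%E.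

(* The infimum is +oo if no horizontal path joins p to q, which does not happen
   under the Hormander condition. *)
Definition cc_dist (R : realType) (m l : nat) (A : 'I_l -> 'M[R]_m)
    (p q : carnot R m l) : \bar R :=
  ereal_inf [set path_length u | u in
    [set u | exists gamma, [/\ horizontal A gamma u, gamma 0 = p
                             & gamma 1 = q]]].

Definition cc_dist0 (R : realType) (m l : nat) (A : 'I_l -> 'M[R]_m)
    (p : carnot R m l) : \bar R := cc_dist A 0 p.

(* gamma_u(1), where gamma_u is the horizontal path from 0 with control u. *)
Definition endpoint (R : realType) (m l : nat) (A : 'I_l -> 'M[R]_m)
    (u : R -> 'rV[R]_m) : carnot R m l :=
  get [set p : carnot R m l |
    exists gamma, [/\ horizontal A gamma u, gamma 0 = 0 & gamma 1 = p]].

(* L is the Frechet differential at u of F : L^2((0, 1), R^m) -> R^n. *)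
Definition frechet (R : realType) (m l : nat)
    (F : (R -> 'rV[R]_m) -> carnot R m l) (u : R -> 'rV[R]_m)
    (L : (R -> 'rV[R]_m) -> carnot R m l) : Prop :=
  [/\ forall (c : R) v w, L2vec v -> L2vec w ->
        L (fun s => c *: v s + w s) = c *: L v + L w,
      exists M : R, forall v, L2vec v -> enormG (L v) <= M * L2norm v
    & forall e : R, 0 < e -> exists2 d : R, 0 < d &
        forall v, L2vec v -> L2norm v <= d ->
          enormG (F (fun s => u s + v s) - F u - L v) <= e * L2norm v].

Definition abnormal (R : realType) (m l : nat) (A : 'I_l -> 'M[R]_m)
    (u : R -> 'rV[R]_m) : Prop :=
  exists2 dE, frechet (endpoint A) u dE &
    exists2 xi : carnot R m l, xi <> 0 &
      forall v, L2vec v -> dotG xi (dE v) = 0.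

Definition abnormal_minimizer_from_origin (R : realType) (m l : nat)
    (A : 'I_l -> 'M[R]_m) (gamma : R -> carnot R m l) : Prop :=
  gamma 0 = 0 /\
  exists u : R -> 'rV[R]_m,
    [/\ horizontal A gamma u, path_length u = cc_dist A (gamma 0) (gamma 1)
      & abnormal A u].

(* Main.v *)
Require Import Defs.
From mathcomp Require Import all_boot all_order all_algebra.
From mathcomp Require Import all_classical all_reals all_analysis.
From mathcomp Require Import measurable_realfun.
From mathcomp Require Import ring lra.

Set Implicit Arguments.
Unset Strict Implicit.
Unset Printing Implicit Defensive.

Import Order.TTheory GRing.Theory Num.Theory.
Import numFieldNormedType.Exports.

Local Open Scope classical_set_scope.
Local Open Scope ring_scope.

(** Write K(tau) for the skew-symmetric matrix sum_a tau_a A^a.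

    Where abnormality comes from.  The endpoint of a control u consists of its
    integral x(1) and of the areas 1/2 int <x, A u>, where x is the primitive
    of u ([endpointE]).  If a covector (xi, tau) annihilates the differential
    of this map at u, then testing it on a well chosen variation gives
    K(tau) x(s) = 0 for all s, and forces tau <> 0 ([abnormal_kernel]).  So the
    projected path stays in the kernel of a nonzero skew-symmetric matrix
    K = K(tau); let P be the orthogonal projection onto this kernel
    ([kernel_projection]).

    Which direction to move in.  Take for sigma the vertical vector whose area
    matrix is K, so that <tau, sigma> = |K|^2 / 2 > 0.  Let w be any control
    whose endpoint is (x, t + beta sigma), and split w = wP + w(1 - P).  As
    K = (1 - P) K (1 - P), the pairing of tau with the vertical endpoint only
    sees the area swept by w(1 - P), which is at most the square of the length
    b of that component; hence c |beta| <= b^2 for some c > 0.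

    On the other hand the length a of wP is at least D = d(x, t).  When t = 0
    this holds because wP joins 0 to x, and d(x, 0) = |x|.  In the free case it
    holds because the vertical coordinate determines the antisymmetric part of
    the area matrix ([vert_inj_skew]); conjugation by P maps that of w to that
    of the minimizer, and therefore wP is itself a control with endpoint (x, t)
    ([endp_projection]).

    Pythagoras for lengths ([length_pythagoras]) now gives
    length w >= sqrt (a^2 + b^2) >= sqrt (D^2 + c |beta|) >= D + C |beta|
    for |beta| <= 1 ([length_growth]).

    All this needs horizontal paths to be determined by their controls, that is
    the fundamental theorem of calculus for functions with a weak derivative
    ([W12_primitive], by the du Bois-Reymond argument) and its converse
    ([W12_prim], by Fubini's theorem through [by_parts]). *)

(** * Integrals over the unit interval *)

Section UnitIntervalIntegrals.
Variable R : realType.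
Implicit Types f g h : R -> R.

Definition L1fun f : Prop :=
  lebesgue_measure.-integrable (`]0, 1[ : set R) (EFin \o f).

Definition int01 f : R := \int[lebesgue_measure]_(s in `]0, 1[) f s.

(** The multipliers that preserve integrability and square integrability. *)
Definition bdd01 f : Prop :=
  measurable_fun (`]0, 1[ : set R) f /\ exists M, forall s, 0 < s < 1 -> `|f s| <= M.

Lemma mu01 : lebesgue_measure (`]0, 1[ : set R) = 1%E.
Proof. by rewrite lebesgue_measure_itv/= lte01 sube0. Qed.

Lemma eq_int01 f g : (forall s, 0 < s < 1 -> f s = g s) -> int01 f = int01 g.
Proof. by move=> fg; apply: eq_Rintegral => s; rewrite inE/= in_itv => /fg. Qed.

Lemma L1_eq f g : (forall s, 0 < s < 1 -> f s = g s) -> L1fun f -> L1fun g.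
Proof.
move=> fg; apply: eq_integrable => // s.
by rewrite inE/= in_itv => /fg ->.
Qed.

Lemma L1D f g : L1fun f -> L1fun g -> L1fun (fun s => f s + g s).
Proof. by move=> Lf Lg; exact: (integrableD _ Lf Lg). Qed.

Lemma L1Z c f : L1fun f -> L1fun (fun s => c * f s).
Proof. by move=> Lf; exact: (integrableZl _ _ Lf). Qed.

Lemma L1cst c : L1fun (fun=> c).
Proof.
apply: measurable_bounded_integrable => //.
- by rewrite [X in (X < _)%E]mu01 ltry.
- by exists `|c|; split; [exact: num_real|move=> M cM s _; exact: ltW].
Qed.

Lemma L1sum (I : Type) (r : seq I) (F : I -> R -> R) :
  (forall i, L1fun (F i)) -> L1fun (fun s => \sum_(i <- r) F i s).
Proof.
move=> LF; elim: r => [|i r IH].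
  by apply: L1_eq (L1cst 0) => s _; rewrite big_nil.
by apply: L1_eq (L1D (LF i) IH) => s _; rewrite big_cons.
Qed.

Lemma L1norm f : L1fun f -> L1fun (fun s => `|f s|).
Proof. exact: integrable_norm. Qed.

Lemma L1_meas f : L1fun f -> measurable_fun (`]0, 1[ : set R) f.
Proof. by move=> /measurable_int /measurable_EFinP. Qed.

Lemma L1_le f g : measurable_fun (`]0, 1[ : set R) f -> L1fun g ->
  (forall s, 0 < s < 1 -> `|f s| <= g s) -> L1fun f.
Proof.
move=> mf Lg fg; apply: le_integrable Lg => //; first exact/measurable_EFinP.
move=> s; rewrite /= in_itv => /fg fgs.
by rewrite lee_fin (le_trans fgs)// ler_norm.
Qed.

Lemma L1M_bdd f g : bdd01 f -> L1fun g -> L1fun (fun s => f s * g s).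
Proof.
move=> [mf [M fM]] Lg; apply: (@L1_le _ (fun s => M * `|g s|)).
- by apply: measurable_funM => //; exact: L1_meas.
- exact/L1Z/L1norm.
- by move=> s s01; rewrite normrM ler_wpM2r// fM.
Qed.

Lemma int01D f g : L1fun f -> L1fun g ->
  int01 (fun s => f s + g s) = int01 f + int01 g.
Proof. by move=> Lf Lg; exact: RintegralD. Qed.

Lemma int01Z c f : L1fun f -> int01 (fun s => c * f s) = c * int01 f.
Proof. by move=> Lf; exact: RintegralZl. Qed.

Lemma int01B f g : L1fun f -> L1fun g ->
  int01 (fun s => f s - g s) = int01 f - int01 g.
Proof. by move=> Lf Lg; exact: RintegralB. Qed.

Lemma int01_cst c : int01 (fun=> c) = c.
Proof. by rewrite /int01 Rintegral_cst// [X in fine X]mu01 mulr1. Qed.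

Lemma int01_sum (I : Type) (r : seq I) (F : I -> R -> R) :
  (forall i, L1fun (F i)) ->
  int01 (fun s => \sum_(i <- r) F i s) = \sum_(i <- r) int01 (F i).
Proof.
move=> LF; elim: r => [|i r IH].
  rewrite big_nil -[RHS](int01_cst 0).
  by apply: eq_int01 => s _; rewrite big_nil.
rewrite big_cons -IH -int01D//; last exact: L1sum.
by apply: eq_int01 => s _; rewrite big_cons.
Qed.

Lemma int01_le f g : L1fun f -> L1fun g ->
  (forall s, 0 < s < 1 -> f s <= g s) -> int01 f <= int01 g.
Proof.
by move=> Lf Lg fg; apply: le_Rintegral.
Qed.

Lemma int01_ge0 f : (forall s, 0 < s < 1 -> 0 <= f s) -> 0 <= int01 f.
Proof. by move=> f0; apply: Rintegral_ge0 => s; rewrite /= in_itv => /f0. Qed.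

Lemma le_norm_int01 f : L1fun f -> `|int01 f| <= int01 (fun s => `|f s|).
Proof. by move=> Lf; exact: le_normr_Rintegral. Qed.

(** The passage between extended-real integrals, in which lengths are measured,
    and real ones. *)
Lemma integral01_EFin f : L1fun f ->
  (\int[lebesgue_measure]_(s in `]0%R, 1%R[) (f s)%:E = (int01 f)%:E)%E.
Proof. by move=> Lf; rewrite /int01 /Rintegral fineK//; exact: integrable_fin_num. Qed.

Definition ae01 (P : R -> Prop) : Prop :=
  {ae lebesgue_measure, forall s : R, 0 < s < 1 -> P s}.

Lemma ae01S (P Q : R -> Prop) : (forall s, 0 < s < 1 -> P s -> Q s) ->
  ae01 P -> ae01 Q.
Proof.
move=> PQ; apply: (@filterS _ _ (ae_filter_ringOfSetsType _)) => s Ps s01.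
by apply: PQ => //; exact: Ps.
Qed.

Lemma int01_ae f g : measurable_fun (`]0, 1[ : set R) f ->
  measurable_fun (`]0, 1[ : set R) g -> ae01 (fun s => f s = g s) ->
  int01 f = int01 g.
Proof.
move=> mf mg fg; congr fine; apply: ae_eq_integral => //.
- exact/measurable_EFinP.
- exact/measurable_EFinP.
- move: fg; apply: (@filterS _ _ (ae_filter_ringOfSetsType _)) => s + s01.
  by move: s01; rewrite /= in_itv/= => /[swap] /[apply] ->.
Qed.

Lemma L2_meas f : L2fun f -> measurable_fun (`]0, 1[ : set R) f.
Proof. by case. Qed.

Lemma L2_sqr f : L2fun f -> L1fun (fun s => f s ^+ 2).
Proof.
move=> [mf f2]; apply/integrableP; split.
  by apply/measurable_EFinP; exact: measurable_funX.
move: f2; congr (_ < _)%E; apply: eq_integral => s _ /=.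
by rewrite ger0_norm// sqr_ge0.
Qed.

Lemma L2_of_sqr f : measurable_fun (`]0, 1[ : set R) f ->
  L1fun (fun s => f s ^+ 2) -> L2fun f.
Proof.
move=> mf Lf; split=> //; move/integrableP : Lf => [_].
congr (_ < _)%E; apply: eq_integral => s _ /=.
by rewrite ger0_norm// sqr_ge0.
Qed.

Lemma L2M f g : L2fun f -> L2fun g -> L1fun (fun s => f s * g s).
Proof.
move=> Lf Lg; apply: (@L1_le _ (fun s => f s ^+ 2 + g s ^+ 2)).
- by apply: measurable_funM; exact: L2_meas.
- by apply: L1D; exact: L2_sqr.
- move=> s _; rewrite normrM -(real_normK (num_real (f s))).
  by rewrite -(real_normK (num_real (g s))); nra.
Qed.

Lemma L2_bdd f : bdd01 f -> L2fun f.
Proof.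
move=> [mf [M fM]]; apply: L2_of_sqr => //.
apply: (@L1_le _ (fun=> M ^+ 2)); first exact: measurable_funX.
- exact: L1cst.
- move=> s s01; rewrite normrX ler_pXn2r ?nnegrE// ?fM//.
  by rewrite (le_trans _ (fM _ s01)).
Qed.

Lemma bdd_cst c : bdd01 (fun=> c).
Proof. by split; [exact: measurable_cst|exists `|c|]. Qed.

Lemma bddM f g : bdd01 f -> bdd01 g -> bdd01 (fun s => f s * g s).
Proof.
move=> [mf [M fM]] [mg [N gN]]; split; first exact: measurable_funM.
by exists (M * N) => s s01; rewrite normrM ler_pM ?fM ?gN.
Qed.

Lemma L2_L1 f : L2fun f -> L1fun f.
Proof.
move=> Lf; apply: L1_eq (L2M (L2_bdd (bdd_cst 1)) Lf) => s _.
by rewrite mul1r.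
Qed.

Lemma L2D f g : L2fun f -> L2fun g -> L2fun (fun s => f s + g s).
Proof.
move=> Lf Lg; apply: L2_of_sqr.
  by apply: measurable_funD; exact: L2_meas.
have L := L1D (L1D (L2_sqr Lf) (L1Z 2 (L2M Lf Lg))) (L2_sqr Lg).
by apply: L1_eq L => s _; ring.
Qed.

Lemma L2M_bdd f g : bdd01 f -> L2fun g -> L2fun (fun s => f s * g s).
Proof.
move=> bf Lg; apply: L2_of_sqr.
  by apply: measurable_funM; [case: bf|exact: L2_meas].
apply: L1_eq (L1M_bdd (bddM bf bf) (L2_sqr Lg)) => s _.
by rewrite exprMn expr2.
Qed.

Lemma L2Z c f : L2fun f -> L2fun (fun s => c * f s).
Proof. exact/L2M_bdd/bdd_cst. Qed.

Lemma L2sum (I : Type) (r : seq I) (F : I -> R -> R) :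
  (forall i, L2fun (F i)) -> L2fun (fun s => \sum_(i <- r) F i s).
Proof.
move=> LF; elim: r => [|i r IH].
  rewrite (_ : (fun _ => _) = fun=> 0); first exact/L2_bdd/bdd_cst.
  by apply/funext => s; rewrite big_nil.
rewrite (_ : (fun _ => _) = fun s => F i s + \sum_(i <- r) F i s).
  exact: L2D.
by apply/funext => s; rewrite big_cons.
Qed.

Lemma within_bdd01 f : {within `[0, 1], continuous f} -> bdd01 f.
Proof.
move=> cf; split.
  apply: (@measurable_funS _ _ _ _ (`[0%R, 1%R]%classic : set R)) => //.
    exact: subset_itvW.
  by apply: subspace_continuous_measurable_fun.
have /compact_bounded[M [_ mrt]] :=
  continuous_compact cf (@segment_compact _ _ _).
exists (M + 1) => s s01; apply: mrt; first by rewrite ltrDl.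
exists s => //=; rewrite in_itv/=; lra.
Qed.

End UnitIntervalIntegrals.

(** * Primitives and integration by parts *)

Section Primitives.
Variable R : realType.
Implicit Types f g h : R -> R.

Lemma bdd_indic (b : R -> bool) : measurable_fun (`]0, 1[ : set R) b ->
  bdd01 (fun r => (b r)%:R).
Proof.
move=> mb; split; last first.
  by exists 1 => r _; case: (b r); rewrite ?normr1 ?normr0 ?ler01.
rewrite (_ : (fun _ => _) = fun r => if b r then 1 else 0).
  by apply: measurable_fun_if.
by apply/funext => r; case: (b r).
Qed.

Lemma bdd_le (s : R) : bdd01 (fun r : R => (r <= s)%R%:R).
Proof.
by apply: bdd_indic; apply: measurable_fun_ler => //; exact: measurable_cst.
Qed.

Lemma bdd_ge (r : R) : bdd01 (fun s : R => (r <= s)%R%:R).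
Proof.
by apply: bdd_indic; apply: measurable_fun_ler => //; exact: measurable_cst.
Qed.

(** Fubini's theorem on the triangle r <= s, for the integrable function
    f(r) g(s) cut off by the indicator of the triangle. *)
Lemma int01_swap f g : L1fun f -> L1fun g ->
  int01 (fun s => int01 (fun r => f r * (r <= s)%R%:R) * g s) =
  int01 (fun r => f r * int01 (fun s => (r <= s)%R%:R * g s)).
Proof.
move=> Lf Lg; pose D : set R := `]0%R, 1%R[%classic.
have pDE h r : (h \_ D) r = if r \in D then h r else 0 :> R by rewrite patchE.
pose F (p : R * R) : R := if p.1 <= p.2 then (f \_ D) p.1 * (g \_ D) p.2 else 0.
have mD : measurable D by exact: measurable_itv.
have Lf' : lebesgue_measure.-integrable setT (EFin \o (f \_ D)).
  by rewrite -restrict_EFin -integrable_mkcond.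
have Lg' : lebesgue_measure.-integrable setT (EFin \o (g \_ D)).
  by rewrite -restrict_EFin -integrable_mkcond.
have mf' : measurable_fun setT (f \_ D).
  by move/measurable_int : Lf' => /measurable_EFinP.
have mg' : measurable_fun setT (g \_ D).
  by move/measurable_int : Lg' => /measurable_EFinP.
have mF : measurable_fun setT (EFin \o F).
  apply/measurable_EFinP; apply: measurable_fun_ifT => //.
  - by apply: measurable_fun_ler; [exact: measurable_fst|exact: measurable_snd].
  - by apply: measurable_funM; [exact: measurableT_comp|exact: measurableT_comp].
pose G (p : R * R) : R := `|(f \_ D) p.1| * `|(g \_ D) p.2|.
have mG : measurable_fun setT (EFin \o G).
  by apply/measurable_EFinP; apply: measurable_funM;
    do 2 apply: measurableT_comp => //.
have intG : (lebesgue_measure \x lebesgue_measure)%E.-integrable setT (EFin \o G).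
  apply/(@integrable12ltyP _ _ _ _ _ lebesgue_measure lebesgue_measure _ mG).
  rewrite (@eq_integral _ _ _ lebesgue_measure setT (fun r => (`|(f \_ D) r|)%:E *
      \int[lebesgue_measure]_s `|((g \_ D) s)%:E|)%E); last first.
    move=> r _; rewrite -ge0_integralZl//; last first.
      by do 2 apply: measurableT_comp => //.
    by apply: eq_integral => s _ /=; rewrite normrM !normr_id.
  move/integrableP : Lg' => [_ Lg'oo].
  rewrite ge0_integralZr//; last 2 first.
    by do 2 apply: measurableT_comp => //.
    exact: integral_ge0.
  rewrite lte_mul_pinfty//.
  - exact: integral_ge0.
  - rewrite ge0_fin_numE; last exact: integral_ge0.
    by move/integrableP : Lf' => [].
have intF : (lebesgue_measure \x lebesgue_measure)%E.-integrable setT (EFin \o F).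
  apply: le_integrable intG => //= -[r s] _; rewrite lee_fin /F /G/=.
  case: ifP => _; last by rewrite normr0 normr_ge0.
  by rewrite [leRHS]ger0_norm ?normrM// mulr_ge0.
have := Fubini intF; rewrite /= => FF.
have inner1 r : (\int[lebesgue_measure]_s (F (r, s))%:E =
    ((f \_ D) r * int01 (fun s => (r <= s)%R%:R * g s))%:E)%E.
  have Lrg : L1fun (fun s => (r <= s)%R%:R * g s).
    exact: L1M_bdd (bdd_ge r) Lg.
  rewrite EFinM -integral01_EFin// -integralZl// integral_mkcond.
  apply: eq_integral => s _; rewrite patchE /F/= (pDE g).
  case: (s \in D); last by rewrite mulr0 if_same.
  by case: ifP; rewrite -EFinM ?mul1r// mul0r mulr0.
have inner2 s : (\int[lebesgue_measure]_r (F (r, s))%:E =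
    (int01 (fun r => f r * (r <= s)%R%:R) * (g \_ D) s)%:E)%E.
  have Lrf : L1fun (fun r => f r * (r <= s)%R%:R).
    by apply: L1_eq (L1M_bdd (bdd_le s) Lf) => r _; rewrite mulrC.
  rewrite EFinM -integral01_EFin// -integralZr// integral_mkcond.
  apply: eq_integral => r _; rewrite patchE /F/= (pDE f).
  case: (r \in D); last by rewrite mul0r if_same.
  by case: ifP; rewrite -EFinM ?mulr1// mulr0 mul0r.
rewrite /int01/= Rintegral_mkcond [RHS]Rintegral_mkcond; congr fine.
transitivity (\int[lebesgue_measure]_s \int[lebesgue_measure]_r (F (r, s))%:E)%E.
  apply: eq_integral => s _; rewrite inner2 (pDE g) (pDE (fun s => _ * g s)).
  by case: ifP => _; rewrite ?mulr0.
(* both sides are now the iterated integrals of F over the plane *)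
rewrite -FF; apply: eq_integral => r _; rewrite inner1 (pDE f) (pDE (fun s => f s * _)).
by case: ifP => _; rewrite ?mul0r.
Qed.

(** The primitive vanishing at 0.  Integrating over the fixed interval against
    an indicator lets it inherit every property of [int01]. *)
Definition prim f (s : R) : R := int01 (fun r => f r * (r <= s)%R%:R).

Lemma L1M_le f s : L1fun f -> L1fun (fun r => f r * (r <= s)%R%:R).
Proof.
by move=> Lf; apply: L1_eq (L1M_bdd (bdd_le s) Lf) => r _; rewrite mulrC.
Qed.

Lemma prim0 f : prim f 0 = 0.
Proof.
rewrite -[RHS](int01_cst 0); apply: eq_int01 => r /andP[r0 _].
by rewrite leNgt r0 mulr0.
Qed.

Lemma prim1 f : prim f 1 = int01 f.
Proof. by apply: eq_int01 => r /andP[_ r1]; rewrite (ltW r1) mulr1. Qed.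

Lemma eq_prim f g s : (forall s, 0 < s < 1 -> f s = g s) -> prim f s = prim g s.
Proof. by move=> fg; apply: eq_int01 => r /fg ->. Qed.

Lemma primD f g s : L1fun f -> L1fun g ->
  prim (fun r => f r + g r) s = prim f s + prim g s.
Proof.
move=> Lf Lg; rewrite /prim -int01D; [|exact: L1M_le|exact: L1M_le].
by apply: eq_int01 => r _; rewrite mulrDl.
Qed.

Lemma primZ c f s : L1fun f -> prim (fun r => c * f r) s = c * prim f s.
Proof.
move=> Lf; rewrite /prim -int01Z; last exact: L1M_le.
by apply: eq_int01 => r _; rewrite mulrA.
Qed.

Lemma prim_sum (I : Type) (r : seq I) (F : I -> R -> R) s :
  (forall i, L1fun (F i)) ->
  prim (fun t => \sum_(i <- r) F i t) s = \sum_(i <- r) prim (F i) s.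
Proof.
move=> LF; rewrite /prim -int01_sum; last by move=> i; exact: L1M_le.
by apply: eq_int01 => t _; rewrite mulr_suml.
Qed.

Lemma prim_ae f g s : measurable_fun (`]0, 1[ : set R) f ->
  measurable_fun (`]0, 1[ : set R) g -> ae01 (fun s => f s = g s) ->
  prim f s = prim g s.
Proof.
move=> mf mg fg; have ml := (bdd_le s).1; apply: int01_ae.
- exact: measurable_funM.
- exact: measurable_funM.
- by apply: ae01S fg => r _ ->.
Qed.

Lemma prim_norm_le f s : L1fun f -> `|prim f s| <= int01 (fun r => `|f r|).
Proof.
move=> Lf; apply: (le_trans (le_norm_int01 (L1M_le s Lf))).
apply: int01_le; [exact/L1norm/L1M_le|exact: L1norm|move=> r _].
rewrite normrM; case: (r <= s)%R; rewrite ?normr1 ?mulr1//.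
by rewrite normr0 mulr0.
Qed.

(** The diagonal r = s of the unit square is negligible slice by slice. *)
Lemma int01_set1 g r : L1fun g -> int01 (fun s => (s == r)%:R * g s) = 0.
Proof.
move=> Lg; rewrite -[RHS](int01_cst 0).
have E : (fun s => (s == r)%:R * g s) =
         (fun s => g s * (s <= r)%R%:R + (-1) * (g s * (1 - (r <= s)%R%:R))).
  apply/funext => s; by have [sr|rs|->] := ltgtP s r; rewrite /= ?mulr1n ?mulr0n; ring.
apply: int01_ae.
- rewrite E; apply: measurable_funD; first exact: (L1_meas (L1M_le r Lg)).
  apply: measurable_funM => //; apply: measurable_funM; first exact: L1_meas.
  by apply: measurable_funB => //; case: (bdd_ge r).
- exact: measurable_cst.
exists [set r]; split => //; first exact: lebesgue_measure_set1.
move=> s /=; apply: contra_notP => /eqP sr s01.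
by rewrite (negbTE sr) mul0r.
Qed.

Lemma prim_within f : L1fun f -> {within `[0, 1], continuous (prim f)}.
Proof.
move=> Lf; pose D : set R := `]0%R, 1%R[%classic.
have mD : measurable D by exact: measurable_itv.
have Lf' : lebesgue_measure.-integrable `[0%R, 1%R] (EFin \o (f \_ D)).
  apply: integrableS (_ : lebesgue_measure.-integrable setT _) => //.
  by rewrite -restrict_EFin -integrable_mkcond.
have := parameterized_integral_continuous ler01 Lf'.
apply: subspace_eq_continuous => s.
rewrite inE/= in_itv/= => /andP[s0 s1].
rewrite /parameterized_integral /prim /int01.
rewrite /from_subspace Rintegral_mkcond [RHS]Rintegral_mkcond; apply: eq_Rintegral => r _.
rewrite !patchE /= -/D.
have [|rD] := boolP (r \in D); last by rewrite if_same.
rewrite inE /D/= in_itv/= => /andP[r0 r1].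
have [rs|rs] := boolP (r <= s).
  by rewrite mem_set ?mulr1//= in_itv/= (ltW r0).
by rewrite memNset ?mulr0//= in_itv/= (negbTE rs) andbF.
Qed.

Lemma prim_bdd f : L1fun f -> bdd01 (prim f).
Proof. by move=> Lf; exact/within_bdd01/prim_within. Qed.

Lemma int01_ge g r : L1fun g ->
  int01 (fun s => (r <= s)%R%:R * g s) = int01 g - prim g r.
Proof.
move=> Lg; have L1 := L1M_bdd (bdd_ge r) Lg; have L2 := L1M_le r Lg.
have L3 : L1fun (fun s => (s == r)%:R * g s).
  have L3 := L1D (L1D L1 L2) (L1Z (-1) Lg).
  apply: L1_eq L3 => s _.
  by have [sr|rs|->] := ltgtP s r; rewrite /= ?mulr1n ?mulr0n; ring.
(* [r <= s] = 1 - [s <= r] + [s = r] *)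
rewrite /prim -int01B// -[RHS]addr0 -(int01_set1 r Lg) -int01D//; last first.
  by apply: L1_eq (L1D Lg (L1Z (-1) L2)) => s _; rewrite mulN1r.
apply: eq_int01 => s _.
by have [sr|rs|->] := ltgtP s r; rewrite /= ?mulr1n ?mulr0n; ring.
Qed.

Lemma L1M_prim f g : L1fun f -> L1fun g -> L1fun (fun r => f r * prim g r).
Proof.
move=> Lf Lg; apply: L1_eq (L1M_bdd (prim_bdd Lg) Lf) => s _.
by rewrite mulrC.
Qed.

(** The two iterated integrals are over the triangles r <= s and s <= r, which
    cover the square up to its diagonal; no differentiation is involved. *)
Lemma by_parts f g : L1fun f -> L1fun g ->
  int01 (fun s => prim f s * g s) + int01 (fun s => f s * prim g s) =
  int01 f * int01 g.
Proof.
move=> Lf Lg; rewrite int01_swap//.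
rewrite (_ : int01 (fun r => f r * int01 _) =
    int01 f * int01 g - int01 (fun s => f s * prim g s)) ?subrK//.
rewrite mulrC -int01Z// -int01B; [|exact: L1Z|exact: L1M_prim].
by apply: eq_int01 => r _; rewrite int01_ge//; ring.
Qed.

End Primitives.

(** * Absolutely continuous representatives of Sobolev functions *)

Section Sobolev.
Variable R : realType.
Implicit Types f g h : R -> R.

(** Starting the integral at -oo makes the differentiation theorem available
    at every real point, without boundary cases. *)
Lemma prim_Ny f s : (forall r, ~~ (0 < r < 1) -> f r = 0) ->
  prim f s = \int[lebesgue_measure]_(r in `]-oo, s]) f r.
Proof.
move=> f0; rewrite /prim /int01 Rintegral_mkcond [RHS]Rintegral_mkcond.
apply: eq_Rintegral => r _; rewrite !patchE !mem_setE !in_itv/=.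
by case: ifPn => [_|/f0 ->]; case: (r <= s); rewrite ?mulr1 ?mulr0.
Qed.

Lemma prim_derive f : continuous f -> (forall r, ~~ (0 < r < 1) -> f r = 0) ->
  forall s, derivable (prim f) s 1 /\ derive1 (prim f) s = f s.
Proof.
move=> cf f0 s.
have Lf : L1fun f.
  by apply/L2_L1/L2_bdd/within_bdd01; exact: continuous_subspaceT.
have E : prim f = fun s => \int[lebesgue_measure]_(r in `]-oo, s]) f r.
  by apply/funext => r; exact: prim_Ny.
rewrite E.
apply: (@continuous_FTC1 _ f -oo%O s (s + 1)) => //; last exact: cf.
- by rewrite ltrDl.
- have -> : EFin \o f = (EFin \o f) \_ (`]0, 1[%classic : set R).
    apply/funext => r; rewrite patchE mem_setE in_itv/=.
    by case: ifPn => //= /f0 ->.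
  apply/integrable_restrict => //; apply: integrableS Lf => //.
  by apply: measurableI; exact: measurable_itv.
- exact: ltNyr.
Qed.

Lemma prim_itv f s : lebesgue_measure.-integrable `[0, 1] (EFin \o f) ->
  0 <= s <= 1 -> prim f s = \int[lebesgue_measure]_(r in `[0, s]) f r.
Proof.
move=> If /andP[s0 s1].
rewrite -Rintegral_itv_obnd_cbnd; last first.
  apply: integrableS If => //.
  by apply: subset_itv; rewrite bnd_simp.
move: s1; rewrite le_eqVlt => /predU1P[->|s1].
  rewrite prim1 /int01 Rintegral_itv_bndo_bndc//.
  by apply: integrableS If => //; apply: subset_itv; rewrite bnd_simp.
rewrite /prim /int01 Rintegral_mkcond [RHS]Rintegral_mkcond.
apply: eq_Rintegral => r _; rewrite !patchE !mem_setE !in_itv/=.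
have [rs|rs] := leP r s; last by rewrite mulr0 if_same andbF.
by rewrite mulr1 (le_lt_trans rs s1).
Qed.

Lemma prim_FTC f s : (forall r, derivable f r 1) -> continuous (derive1 f) ->
  0 <= s <= 1 -> prim (derive1 f) s = f s - f 0.
Proof.
move=> df cf /andP[+ s1]; rewrite le_eqVlt => /predU1P[<-|s0].
  by rewrite prim0 subrr.
have cf' : continuous f.
  by move=> r; apply: differentiable_continuous; exact/derivable1_diffP.
rewrite prim_itv; last by rewrite ltW.
  have c1 : {within `[0, s], continuous (derive1 f)} by exact: continuous_subspaceT.
  have c2 : derivable_oo_LRcontinuous f 0 s.
    split=> //; first by apply: cvg_at_right_filter; exact: cf'.
    by apply: cvg_at_left_filter; exact: cf'.
  have FTC := @continuous_FTC2 R (derive1 f) f 0 s s0 c1 c2 (fun _ _ => erefl).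
  by rewrite /Rintegral FTC.
- apply: continuous_compact_integrable; first exact: segment_compact.
  exact: continuous_subspaceT.
Qed.

Lemma prim_cst1 s : 0 <= s <= 1 -> prim (fun=> 1 : R) s = s.
Proof.
move=> s01; rewrite prim_itv//; last first.
  apply: continuous_compact_integrable; first exact: segment_compact.
  by apply: continuous_subspaceT => r; exact: cvg_cst.
rewrite Rintegral_cst// [X in fine X]lebesgue_measure_itv/= mul1r lte_fin.
move: s01 => /andP[+ _]; rewrite le_eqVlt => /predU1P[<-|->]; first by rewrite ltxx.
by rewrite -EFinB subr0.
Qed.

(** At a point where h > 0, continuity bounds h from below on an interval of
    positive length contained in the unit interval. *)
Lemma cont_int01_eq0 h : {within `[0, 1], continuous h} ->
  (forall s, 0 <= s <= 1 -> 0 <= h s) -> int01 h = 0 ->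
  forall s, 0 <= s <= 1 -> h s = 0.
Proof.
move=> ch h0 ih s s01; apply/eqP; rewrite eq_le h0// andbT leNgt; apply/negP.
move=> hs; have bh := within_bdd01 ch.
have Lh : L1fun h by exact/L2_L1/L2_bdd.
have e0 : 0 < h s / 2 by rewrite divr_gt0.
move/subspace_continuousP : ch => /(_ s).
rewrite /= in_itv/= => /(_ s01)/cvgrPdist_lt/(_ _ e0).
rewrite near_withinE => -[d /= d0 hd].
(* halving the radius d keeps the closed interval within the open ball *)
pose a := Num.max 0 (s - d / 2); pose b := Num.min 1 (s + d / 2).
have ab : [/\ 0 <= a, a < b, b <= 1, s - d / 2 <= a & b <= s + d / 2].
  have /andP[s0 s1] := s01.
  by rewrite /a /b; split; rewrite ?le_max ?ge_min ?lexx ?orbT// gt_max !lt_min; lra.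
clearbody a b; have [a0 ab' b1 sa sb] := ab.
have : h s / 2 * (b - a) <= int01 h; last first.
  by rewrite ih; apply/negP; rewrite -ltNge mulr_gt0// subr_gt0.
have Ea : a = prim (fun=> 1) a by rewrite prim_cst1// a0 (le_trans (ltW ab')).
have Eb : b = prim (fun=> 1) b by rewrite prim_cst1// (le_trans a0 (ltW ab')).
rewrite [X in _ * (X - _) <= _]Eb [X in _ * (_ - X) <= _]Ea.
have La c := L1M_le c (@L1cst R 1).
have Lab : L1fun (fun r : R => 1 * (r <= b)%R%:R - 1 * (r <= a)%R%:R).
  by apply: L1_eq (L1D (La b) (L1Z (-1) (La a))) => r _; rewrite mulN1r.
rewrite /prim -int01B// -int01Z//.
apply: int01_le => [||r r01]; [exact: L1Z|by []|].
have hr0 : 0 <= h r by apply: h0; have /andP[r0 r1] := r01; rewrite !ltW.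
rewrite !mul1r; have [ra|ra] := leP r a.
  by rewrite (le_trans ra (ltW ab')) subrr mulr0.
have [rb|rb] := leP r b; last by rewrite subrr mulr0.
have hd1 : `|s - r| < d by rewrite ltr_norml; lra.
move: hd1 => /hd; rewrite in_itv/= subr0 mulr1 /from_subspace.
have /andP[r0 r1] := r01; rewrite (ltW r0) (ltW r1) => /(_ isT).
by rewrite ltr_norml => /andP[_]; lra.
Qed.

Lemma test_prim (phi : R -> R) : test_function phi ->
  [/\ L1fun (derive1 phi), int01 (derive1 phi) = 0 &
      forall s, 0 < s < 1 -> phi s = prim (derive1 phi) s].
Proof.
move=> [dphi cphi _ sphi].
have out s : ~~ (0 < s < 1) -> phi s = 0.
  move=> s01; apply/eqP; apply: contraNT s01 => phis.
  have : (`]0, 1[%classic : set R) s by apply: sphi; exact: subset_closure.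
  by rewrite /= in_itv.
have p0 : phi 0 = 0 by apply: out; rewrite ltxx.
have p1 : phi 1 = 0 by apply: out; rewrite ltxx andbF.
split.
- by apply/L2_L1/L2_bdd/within_bdd01; exact: continuous_subspaceT.
- by rewrite -prim1 prim_FTC// ?p0 ?p1 ?subrr// ler01 lexx.
- by move=> s /andP[s0 s1]; rewrite prim_FTC// ?p0 ?subr0// !ltW.
Qed.

(** The test functions used below are built from their derivative: its support
    stays away from 0 and 1, and its mean vanishes. *)
Lemma prim_test (psi : R -> R) (e : R) : 0 < e -> continuous psi ->
  (forall s, psi s != 0 -> e <= s <= 1 - e) -> int01 psi = 0 ->
  test_function (prim psi) /\ derive1 (prim psi) = psi.
Proof.
move=> e0 cpsi spsi ipsi.
have out s : ~~ (0 < s < 1) -> psi s = 0.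
  move=> s01; apply/eqP; apply: contraNT s01 => /spsi; lra.
have D := prim_derive cpsi out.
have dE : derive1 (prim psi) = psi by apply/funext => s; have [_ ->] := D s.
have supp : closure [set s | prim psi s != 0] `<=` `[e, 1 - e].
  rewrite [X in _ `<=` X](closure_id _).1; last exact: interval_closed.
  apply: closure_subset => s /=; apply: contraNT; rewrite in_itv/= negb_and -!ltNge.
  move=> /orP[se|se]; apply/eqP; last rewrite -ipsi;
    [rewrite -[RHS](int01_cst 0)|]; apply: eq_int01 => r r01.
    have [rs|rs] := leP r s; last by rewrite mulr0.
    have [->|/spsi] := eqVneq (psi r) 0; rewrite ?mul0r//; lra.
  have [rs|rs] := leP r s; first by rewrite mulr1.
  have [->|/spsi] := eqVneq (psi r) 0; rewrite ?mul0r//; lra.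
split=> //; split => //.
- by move=> s; have [] := D s.
- by rewrite dE.
- apply: (subclosed_compact _ (@segment_compact _ e (1 - e))) => //.
  exact: closed_closure.
- apply: (subset_trans supp) => s /=; rewrite !in_itv/=; lra.
Qed.

Lemma prim_weak_derivative f : L1fun f -> weak_derivative (prim f) f.
Proof.
move=> Lf phi /test_prim[Lp ip pE].
have := by_parts Lf Lp; rewrite ip mulr0 => /eqP; rewrite addr_eq0 => /eqP.
rewrite -/(int01 _) => ->; congr (- _).
by apply: eq_int01 => s /pE ->.
Qed.

Lemma W12_prim f : L2fun f -> W12 (prim f) f.
Proof.
move=> L2f; have Lf := L2_L1 L2f; split => //.
- exact: prim_within.
- exact/L2_bdd/prim_bdd.
- exact: prim_weak_derivative.
Qed.

(** Retraction of the line onto the unit interval: composing with it turns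
    continuity within the interval into continuity on the line. *)
Definition clamp (s : R) : R := Num.max 0 (Num.min 1 s).

Lemma clamp01 s : 0 <= clamp s <= 1.
Proof. by rewrite /clamp le_max lexx ge_max ler01 ge_min lexx. Qed.

Lemma clampE s : 0 <= s <= 1 -> clamp s = s.
Proof. by move=> /andP[s0 s1]; rewrite /clamp min_r// max_r. Qed.

Lemma clamp_continuous h : {within `[0, 1], continuous h} ->
  continuous (h \o clamp).
Proof.
move=> /subspace_continuousP ch s.
have cc : {for s, continuous clamp}.
  apply: continuous_max; first exact: cvg_cst.
  by apply: continuous_min; [exact: cvg_cst|exact: cvg_id].
have hc := ch (clamp s); rewrite /= in_itv/= in hc.
have {}hc := hc (clamp01 s).
apply: cvg_comp hc => P /= wP; rewrite nbhs_simpl/=.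
have : nbhs s (fun r => (`[0, 1]%classic : set R) (clamp r) -> P (clamp r)).
  exact: (cc (fun r => (`[0, 1]%classic : set R) r -> P r) wP).
by apply: filterS => r; apply; rewrite /= in_itv/=; exact: clamp01.
Qed.

Lemma cont_int01_sqr_eq0 h : {within `[0, 1], continuous h} ->
  int01 (fun s => h s * h s) = 0 -> forall s, 0 <= s <= 1 -> h s = 0.
Proof.
move=> /clamp_continuous ch ih s s01.
have chh : continuous (fun s => h (clamp s) * h (clamp s)).
  by move=> r; apply: cvgM; exact: ch.
have i0 : int01 (fun s => h (clamp s) * h (clamp s)) = 0.
  rewrite -[RHS]ih; apply: eq_int01 => r /andP[r0 r1].
  by rewrite clampE// !ltW.
have h0 r : 0 <= r <= 1 -> 0 <= h (clamp r) * h (clamp r).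
  by rewrite -expr2 sqr_ge0.
have := cont_int01_eq0 (continuous_subspaceT chh) h0 i0 s01.
by rewrite clampE// => /eqP; rewrite mulf_eq0 orbb => /eqP.
Qed.

(** Du Bois-Reymond: H = f - prim g is orthogonal to all psi of mean zero with
    compact support.  Taking psi = eta (H - c), with eta a cut-off and c the
    eta-weighted mean of H, gives int eta (H - c)^2 = 0, so that H is constant
    where eta > 0. *)
Lemma W12_primitive f g : W12 f g ->
  forall s, 0 <= s <= 1 -> f s = f 0 + prim g s.
Proof.
move=> [cf L2f L2g wfg].
have Lf := L2_L1 L2f; have Lg := L2_L1 L2g.
pose H s := f s - prim g s.
have cH : {within `[0, 1], continuous H}.
  by apply: within_continuousB => //; exact: prim_within.
pose h := H \o clamp.
have ch : continuous h := clamp_continuous cH.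
have hE s : 0 <= s <= 1 -> h s = H s by move=> s01; rewrite /h /= clampE.
have orth (e : R) (psi : R -> R) : 0 < e -> continuous psi ->
    (forall s, psi s != 0 -> e <= s <= 1 - e) -> int01 psi = 0 ->
    int01 (fun s => H s * psi s) = 0.
  move=> e0 cpsi spsi ipsi; have [tp dp] := prim_test e0 cpsi spsi ipsi.
  have bpsi : bdd01 psi by apply: within_bdd01; exact: continuous_subspaceT.
  have LM (k : R -> R) : L1fun k -> L1fun (fun s => k s * psi s).
    by move=> Lk; apply: L1_eq (L1M_bdd bpsi Lk) => s _; rewrite mulrC.
  have := wfg _ tp; have := prim_weak_derivative Lg tp; rewrite dp => E1 E2.
  transitivity (int01 (fun s => f s * psi s) - int01 (fun s => prim g s * psi s)).
    rewrite -int01B; [|exact: LM|].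
      by apply: eq_int01 => s _; rewrite /H mulrBl.
    by apply: LM; exact/L2_L1/L2_bdd/prim_bdd.
  by rewrite /int01 E1 E2 subrr.
(* the cut-off eta is positive exactly on ]e, 1 - e[ *)
have const e : 0 < e < 1 / 2 -> exists c, forall s, e < s < 1 - e -> H s = c.
  move=> /andP[e0 e1].
  pose eta (s : R) : R := Num.max 0 ((s - e) * (1 - e - s)).
  have ceta : continuous eta.
    pose q (s : R) : R^o := (s - e) * (1 - e - s).
    suff cq : continuous q.
      move=> s; apply: (continuous_max (f := fun=> 0 : R^o) (g := q)); last exact: cq.
      exact: cvg_cst.
    move=> s; apply: cvgM; first by apply: cvgB; [exact: cvg_id|exact: cvg_cst].
    by apply: cvgB; [exact: cvg_cst|exact: cvg_id].
  have eta0 s : 0 <= eta s by rewrite /eta le_max lexx.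
  have cL1 (k : R -> R) : continuous k -> L1fun k.
    move=> ck; apply/L2_L1/L2_bdd/within_bdd01; exact: continuous_subspaceT.
  have ieta : int01 eta != 0.
    have p : 0 < (1 / 2 - e) * (1 - e - 1 / 2) by rewrite mulr_gt0//; lra.
    have half : 0 <= (1 / 2 : R) <= 1 by lra.
    apply/eqP => i0.
    have := cont_int01_eq0 (continuous_subspaceT ceta) (fun s _ => eta0 s) i0 half.
    by move/eqP; rewrite /eta (max_r (ltW p)) gt_eqF.
  have cetah : continuous (fun s => eta s * h s).
    by move=> s; apply: cvgM; [exact: ceta|exact: ch].
  pose c := int01 (fun s => eta s * h s) / int01 eta.
  pose psi (s : R) : R := eta s * (h s - c).
  have cpsi : continuous psi.
    move=> s; apply: cvgM; [exact: ceta|].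
    by apply: cvgB; [exact: ch|exact: cvg_cst].
  have ipsi : int01 psi = 0.
    transitivity (int01 (fun s => eta s * h s) - c * int01 eta).
      rewrite -(int01Z c (cL1 _ ceta)) -int01B; [|exact: cL1|exact/L1Z/cL1].
      by apply: eq_int01 => s _; rewrite /psi; ring.
    by rewrite /c mulfVK// subrr.
  have spsi s : psi s != 0 -> e <= s <= 1 - e.
    rewrite /psi mulf_eq0 negb_or => /andP[+ _].
    apply: contraNT => se; rewrite /eta max_l//.
    move: se; rewrite negb_and -!ltNge => /orP[se|se].
      by rewrite mulr_le0_ge0//; lra.
    by rewrite mulr_ge0_le0//; lra.
  have Hpsi := orth e psi e0 cpsi spsi ipsi.
  have csq : continuous (fun s => eta s * (h s - c) ^+ 2).
    move=> s; rewrite (_ : (fun s => _) = fun s => psi s * (h s - c)).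
      by apply: cvgM; [exact: cpsi|apply: cvgB; [exact: ch|exact: cvg_cst]].
    by apply/funext => r; rewrite /psi; ring.
  have isq : int01 (fun s => eta s * (h s - c) ^+ 2) = 0.
    transitivity (int01 (fun s => h s * psi s) - c * int01 psi).
      rewrite -(int01Z c (cL1 _ cpsi)) -int01B; last 2 first.
      - by apply: cL1 => s; apply: cvgM; [exact: ch|exact: cpsi].
      - exact/L1Z/cL1.
      by apply: eq_int01 => s _; rewrite /psi; ring.
    rewrite ipsi mulr0 subr0 -[RHS]Hpsi.
    by apply: eq_int01 => s /andP[s0 s1]; rewrite hE// !ltW.
  exists c => s se; apply/eqP; rewrite -subr_eq0 -hE; last lra.
  have s01 : 0 <= s <= 1 by lra.
  have := cont_int01_eq0 (continuous_subspaceT csq)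
            (fun r _ => mulr_ge0 (eta0 r) (sqr_ge0 _)) isq s01.
  move/eqP; rewrite mulf_eq0 sqrf_eq0 => /orP[|//].
  have p : 0 < (s - e) * (1 - e - s) by rewrite mulr_gt0//; lra.
  by rewrite /eta (max_r (ltW p)) gt_eqF.
have const01 s : 0 < s < 1 -> H s = H (1 / 2).
  move=> s01; pose e : R := Num.min s (1 - s) / 2.
  have [e0 e1 e2] : [/\ 0 < e, e < s & e < 1 - s].
    rewrite /e; case: (leP s (1 - s)) => ?; split; lra.
  have [|c Hc] := const e; first by rewrite e0; lra.
  by rewrite !Hc//; lra.
have cK : {within `[0, 1], continuous (fun s => H s - H (1 / 2))}.
  by apply: within_continuousB => //; apply: continuous_subspaceT => r; exact: cvg_cst.
have iK : int01 (fun s => (H s - H (1 / 2)) * (H s - H (1 / 2))) = 0.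
  rewrite -[RHS](int01_cst 0); apply: eq_int01 => s s01.
  by rewrite const01// subrr mulr0.
have K0 s : 0 <= s <= 1 -> H s = H (1 / 2).
  by move=> s01; apply/eqP; rewrite -subr_eq0 (cont_int01_sqr_eq0 cK iK s01).
move=> s s01; have := K0 s s01; rewrite -(K0 0) ?lexx ?ler01// /H prim0.
lra.
Qed.

End Sobolev.

(** * Endpoints of horizontal paths *)

Section Endpoints.
Variables (R : realType) (m l : nat) (A : 'I_l -> 'M[R]_m).
Implicit Types (u v w : R -> 'rV[R]_m) (p : carnot R m l).

Definition pos u (s : R) : 'rV[R]_m := \row_j prim (fun r => u r 0 j) s.

(** The polarization of [area], in terms of which the endpoint map is expanded
    around a control. *)
Definition area2 u v : 'M[R]_m :=
  \matrix_(k, j) int01 (fun s => prim (fun r => u r 0 k) s * v s 0 j).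

(** Its antisymmetric part is the signed area swept by the projected path in
    each coordinate plane. *)
Definition area u : 'M[R]_m := area2 u u.

(** The vertical coordinate of a path with area matrix Z. *)
Definition vert (Z : 'M[R]_m) : 'rV[R]_l :=
  \row_a (2^-1 * \sum_k \sum_j A a k j * Z k j).

Definition endp u : carnot R m l := (pos u 1, vert (area u)).

Lemma Xsum1 (c : 'rV[R]_m) p i :
  (\sum_(j < m) c 0 j *: Xfield A j p).1 0 i = c 0 i.
Proof.
rewrite raddf_sum/= summxE (bigD1 i)//= !mxE !eqxx mulr1 big1 ?addr0// => j ji.
by rewrite !mxE eq_sym (negbTE ji) andbF mulr0.
Qed.

Lemma Xsum2 (c : 'rV[R]_m) p a :
  (\sum_(j < m) c 0 j *: Xfield A j p).2 0 a =
  2^-1 * \sum_k \sum_j A a k j * (p.1 0 k * c 0 j).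
Proof.
rewrite raddf_sum/= summxE exchange_big/= mulr_sumr; apply: eq_bigr => j _.
rewrite !mxE mulrCA; congr (_ * _); rewrite mulr_sumr.
by apply: eq_bigr => k _; ring.
Qed.

Lemma L2_prim_mul u k j : L2vec u ->
  L2fun (fun s => prim (fun r => u r 0 k) s * u s 0 j).
Proof. by move=> Lu; apply: L2M_bdd => //; exact/prim_bdd/L2_L1. Qed.

Lemma L2_vert u a : L2vec u ->
  L2fun (fun s => 2^-1 * \sum_k \sum_j A a k j *
             (prim (fun r => u r 0 k) s * u s 0 j)).
Proof.
by move=> Lu; apply/L2Z/L2sum => k; apply: L2sum => j; exact/L2Z/L2_prim_mul.
Qed.

Definition path_of u (s : R) : carnot R m l :=
  (pos u s,
   \row_a (2^-1 * \sum_k \sum_j A a k j *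
             prim (fun r => prim (fun r => u r 0 k) r * u r 0 j) s)).

Lemma path_of_vert u s a : L2vec u ->
  (path_of u s).2 0 a =
  prim (fun s => 2^-1 * \sum_k \sum_j A a k j *
             (prim (fun r => u r 0 k) s * u s 0 j)) s.
Proof.
move=> Lu; have L k j : L1fun (fun s => A a k j * (prim (fun r => u r 0 k) s * u s 0 j)).
  exact/L1Z/L2_L1/L2_prim_mul.
rewrite mxE primZ; last by apply: L1sum => k; apply: L1sum => j.
congr (_ * _); rewrite prim_sum; last by move=> k; exact: L1sum.
apply: eq_bigr => k _; rewrite prim_sum//; apply: eq_bigr => j _.
by rewrite primZ//; exact/L2_L1/L2_prim_mul.
Qed.

Lemma path_of1 u : path_of u 1 = endp u.
Proof.
congr pair; apply/rowP => a; rewrite !mxE; congr (_ * _).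
by apply: eq_bigr => k _; apply: eq_bigr => j _; rewrite mxE prim1.
Qed.

Lemma path_of0 u : path_of u 0 = 0.
Proof.
congr pair; apply/rowP => a; rewrite !mxE ?prim0//.
rewrite big1 ?mulr0// => k _; rewrite big1// => j _.
by rewrite prim0 mulr0.
Qed.

Lemma path_of_horizontal u : L2vec u -> horizontal A (path_of u) u.
Proof.
move=> Lu; split=> //.
exists (fun s => \sum_(j < m) u s 0 j *: Xfield A j (path_of u s)); last first.
  by apply: aeW => s _.
split=> [i|a].
  have := W12_prim (Lu i); congr W12; apply/funext => s; last by rewrite Xsum1.
  by rewrite mxE.
have := W12_prim (L2_vert a Lu); congr W12; apply/funext => s.
  by rewrite path_of_vert.
rewrite Xsum2; congr (_ * _); apply: eq_bigr => k _; apply: eq_bigr => j _.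
by rewrite mxE.
Qed.

(** The first layer of the horizontality equation determines x from u, after
    which the right-hand side of the second layer is a known function. *)
Lemma horizontal_path_of gamma u : horizontal A gamma u -> gamma 0 = 0 ->
  forall s, 0 <= s <= 1 -> gamma s = path_of u s.
Proof.
move=> [Lu [dg [W1 W2] ae]] g0 s s01.
have ae1 i : ae01 (fun s => (dg s).1 0 i = u s 0 i).
  by apply: ae01S ae => r _ ->; rewrite Xsum1.
have mW f g : W12 (R:=R) f g -> measurable_fun (`]0, 1[ : set R) g.
  by case=> _ _ /L2_meas.
have pos1 r i : 0 <= r <= 1 -> (gamma r).1 0 i = prim (fun r => u r 0 i) r.
  move=> r01; rewrite (W12_primitive (W1 i) r01) g0 mxE add0r.
  by apply: prim_ae => //; [exact: mW (W1 i)|exact: L2_meas (Lu i)].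
rewrite [LHS]surjective_pairing; congr pair; apply/rowP => a.
  by rewrite pos1// mxE.
transitivity ((path_of u s).2 0 a) => //.
rewrite (W12_primitive (W2 a) s01) g0 mxE add0r path_of_vert//.
apply: prim_ae; first exact: mW (W2 a).
  exact: L2_meas (L2_vert a Lu).
apply: ae01S ae => r r01 ->; rewrite Xsum2; congr (_ * _).
apply: eq_bigr => k _; apply: eq_bigr => j _; rewrite pos1//.
by have /andP[r0 r1] := r01; rewrite !ltW.
Qed.

Lemma endpointE u : L2vec u -> endpoint A u = endp u.
Proof.
move=> Lu; apply: get_unique.
  exists (path_of u); split; [exact: path_of_horizontal|exact: path_of0|].
  exact: path_of1.
move=> p [g [hg g0 <-]].
by rewrite (horizontal_path_of hg g0) ?lexx ?ler01// path_of1.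
Qed.

Lemma dotp_ge0 (x : 'rV[R]_m) : 0 <= dotp x x.
Proof. by apply: sumr_ge0 => i _; rewrite -expr2 sqr_ge0. Qed.

Lemma enorm_ge0 (x : 'rV[R]_m) : 0 <= enorm x.
Proof. exact: sqrtr_ge0. Qed.

Lemma enorm_sqr (x : 'rV[R]_m) : enorm x ^+ 2 = dotp x x.
Proof. by rewrite sqr_sqrtr// dotp_ge0. Qed.

Lemma coord_le_enorm (x : 'rV[R]_m) i : `|x 0 i| <= enorm x.
Proof.
rewrite -(ler_pXn2r (ltn0Sn 1)) ?nnegrE ?enorm_ge0// enorm_sqr real_normK ?num_real//.
rewrite /dotp (bigD1 i)//= -expr2 lerDl.
by apply: sumr_ge0 => j _; rewrite -expr2 sqr_ge0.
Qed.

Lemma L2_enorm u : L2vec u -> L2fun (fun s => enorm (u s)).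
Proof.
move=> Lu; have L1s : L1fun (fun s => dotp (u s) (u s)).
  by apply: L1sum => j; apply: L2M; exact: Lu.
apply: L2_of_sqr; last by apply: L1_eq L1s => s _; rewrite enorm_sqr.
apply: measurableT_comp (L1_meas L1s).
apply: continuous_measurable_fun; exact: sqrt_continuous.
Qed.

Lemma path_lengthE u : L2vec u -> path_length u = (int01 (fun s => enorm (u s)))%:E.
Proof. by move=> /L2_enorm/L2_L1/integral01_EFin. Qed.

Lemma cc_dist0_le u : L2vec u -> (cc_dist0 A (endp u) <= path_length u)%E.
Proof.
move=> Lu; apply: ereal_inf_lbound; exists u => //; exists (path_of u).
by split; [exact: path_of_horizontal|exact: path_of0|exact: path_of1].
Qed.

Lemma cc_dist0_ge p (c : \bar R) :
  (forall u, L2vec u -> endp u = p -> (c <= path_length u)%E) ->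
  (c <= cc_dist0 A p)%E.
Proof.
move=> H; apply: le_ereal_inf_tmp => _ [u [g [hg g0 g1]] <-].
apply: H; first by case: hg.
by rewrite -path_of1 -(horizontal_path_of hg g0) ?lexx ?ler01.
Qed.

End Endpoints.

(** * The covector of an abnormal control *)

Section Abnormal.
Variables (R : realType) (m : nat).
Implicit Types (u v w : R -> 'rV[R]_m) (K Z : 'M[R]_m).

Lemma L2vecD u v : L2vec u -> L2vec v -> L2vec (fun s => u s + v s).
Proof.
move=> Lu Lv j; have := L2D (Lu j) (Lv j); congr L2fun.
by apply/funext => s; rewrite mxE.
Qed.

Lemma L2vecZ (c : R) u : L2vec u -> L2vec (fun s => c *: u s).
Proof.
move=> Lu j; have := L2Z c (Lu j); congr L2fun.
by apply/funext => s; rewrite mxE.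
Qed.

Lemma posDZ u v h s : L2vec u -> L2vec v ->
  pos (fun s => u s + h *: v s) s = pos u s + h *: pos v s.
Proof.
move=> Lu Lv; apply/rowP => j; rewrite !mxE.
rewrite -primZ -?primD; try exact: L2_L1; try exact/L1Z/L2_L1.
by apply: eq_prim => r _; rewrite !mxE.
Qed.

Lemma L1_prim_mul u v k j : L2vec u -> L2vec v ->
  L1fun (fun s => prim (fun r => u r 0 k) s * v s 0 j).
Proof. by move=> Lu Lv; apply: L1M_bdd; [exact/prim_bdd/L2_L1|exact: L2_L1]. Qed.

Lemma area2_DZl u v w h : L2vec u -> L2vec v -> L2vec w ->
  area2 (fun s => u s + h *: v s) w = area2 u w + h *: area2 v w.
Proof.
move=> Lu Lv Lw; apply/matrixP => k j; rewrite !mxE.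
rewrite -int01Z -?int01D; try exact: L1_prim_mul; try exact/L1Z/L1_prim_mul.
apply: eq_int01 => s _; have := posDZ h s Lu Lv => /rowP/(_ k).
by rewrite !mxE => ->; ring.
Qed.

Lemma area2_DZr u v w h : L2vec u -> L2vec v -> L2vec w ->
  area2 w (fun s => u s + h *: v s) = area2 w u + h *: area2 w v.
Proof.
move=> Lu Lv Lw; apply/matrixP => k j; rewrite !mxE.
rewrite -int01Z -?int01D; try exact: L1_prim_mul; try exact/L1Z/L1_prim_mul.
by apply: eq_int01 => s _; rewrite !mxE; ring.
Qed.

(** Integration by parts, entry by entry: this moves all variations of the
    path onto variations of the control. *)
Lemma area2_parts u v : L2vec u -> L2vec v ->
  area2 u v + (area2 v u)^T = (pos u 1)^T *m pos v 1.
Proof.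
move=> Lu Lv; apply/matrixP => k j; rewrite !mxE big_ord1 !mxE !prim1.
rewrite -by_parts; try exact: L2_L1.
by congr (_ + _); apply: eq_int01 => s _; rewrite mulrC.
Qed.

Definition mxdot K Z : R := \sum_k \sum_j K k j * Z k j.

Lemma mxdotDZr K Z1 Z2 c : mxdot K (Z1 + c *: Z2) = mxdot K Z1 + c * mxdot K Z2.
Proof.
rewrite /mxdot mulr_sumr -big_split/=; apply: eq_bigr => k _.
rewrite mulr_sumr -big_split/=; apply: eq_bigr => j _.
by rewrite !mxE; ring.
Qed.

Lemma mxdotDr K Z1 Z2 : mxdot K (Z1 + Z2) = mxdot K Z1 + mxdot K Z2.
Proof. by rewrite -[Z2]scale1r mxdotDZr mul1r scale1r. Qed.

(** A skew-symmetric matrix pairs with antisymmetric parts only. *)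
Lemma mxdot_skew_tr K Z : K^T = - K -> mxdot K Z^T = - mxdot K Z.
Proof.
move=> Ks; rewrite /mxdot exchange_big -sumrN; apply: eq_bigr => k _.
rewrite -sumrN; apply: eq_bigr => j _; rewrite mxE.
by move/matrixP/(_ k j): Ks; rewrite !mxE => ->; rewrite mulNr.
Qed.

Variables (l : nat) (A : 'I_l -> 'M[R]_m).

Definition pencil (tau : 'rV[R]_l) : 'M[R]_m := \sum_a tau 0 a *: A a.

Lemma pencilE tau k j : pencil tau k j = \sum_a tau 0 a * A a k j.
Proof. by rewrite summxE; apply: eq_bigr => a _; rewrite mxE. Qed.

Lemma pencil_skew tau : skew_family A -> (pencil tau)^T = - pencil tau.
Proof.
move=> sA; apply/matrixP => k j; rewrite !mxE !pencilE -sumrN.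
apply: eq_bigr => a _; move/matrixP/(_ k j): (sA a).
by rewrite !mxE => ->; rewrite mulrN.
Qed.

Lemma dotp_vert tau Z : dotp tau (vert A Z) = 2^-1 * mxdot (pencil tau) Z.
Proof.
transitivity (2^-1 * \sum_a tau 0 a * \sum_k \sum_j A a k j * Z k j).
  by rewrite mulr_sumr; apply: eq_bigr => a _; rewrite mxE; ring.
congr (_ * _); under eq_bigr do rewrite mulr_sumr.
rewrite exchange_big; apply: eq_bigr => k _ /=.
under eq_bigr do rewrite mulr_sumr.
rewrite exchange_big; apply: eq_bigr => j _ /=.
by rewrite pencilE mulr_suml; apply: eq_bigr => a _; ring.
Qed.

Lemma vertDZ Z1 Z2 c : vert A (Z1 + c *: Z2) = vert A Z1 + c *: vert A Z2.
Proof.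
apply/rowP => a; rewrite !mxE mulrCA -mulrDr; congr (_ * _).
exact: (mxdotDZr (A a)).
Qed.

(** The endpoint map is a quadratic polynomial along each line. *)
Lemma endpDZ u v h : L2vec u -> L2vec v ->
  endp A (fun s => u s + h *: v s) =
  endp A u + h *: (pos v 1, vert A (area2 u v + area2 v u))
           + h ^+ 2 *: (0, vert A (area v)).
Proof.
move=> Lu Lv; congr pair; first by rewrite posDZ//= scaler0 addr0.
rewrite /= -!vertDZ; congr vert.
have Luv := L2vecD Lu (L2vecZ h Lv).
rewrite /area area2_DZl// !area2_DZr// scalerDr !scalerDr scalerA -expr2.
by rewrite !addrA; congr (_ + _); rewrite -!addrA; congr (_ + _).
Qed.

Lemma dotGDZ (xi p q : carnot R m l) c : dotG xi (p + c *: q) = dotG xi p + c * dotG xi q.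
Proof.
rewrite /dotG /dotp mulrDr !mulr_sumr addrACA -!big_split/=.
by congr (_ + _); apply: eq_bigr => i _; rewrite !mxE; ring.
Qed.

Lemma enormG_coord1 (p : carnot R m l) i : `|p.1 0 i| <= enormG p.
Proof.
rewrite -(ler_pXn2r (ltn0Sn 1)) ?nnegrE ?sqrtr_ge0// sqr_sqrtr; last first.
  by rewrite addr_ge0// dotp_ge0.
rewrite real_normK ?num_real// /dotG {1}/dotp (bigD1 i)//= -expr2 -addrA lerDl.
rewrite addr_ge0 ?dotp_ge0//.
by apply: sumr_ge0 => j _; rewrite -expr2 sqr_ge0.
Qed.

Lemma enormG_coord2 (p : carnot R m l) i : `|p.2 0 i| <= enormG p.
Proof.
rewrite -(ler_pXn2r (ltn0Sn 1)) ?nnegrE ?sqrtr_ge0// sqr_sqrtr; last first.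
  by rewrite addr_ge0// dotp_ge0.
rewrite real_normK ?num_real// /dotG {2}/dotp (bigD1 i)//= -expr2 addrCA lerDl.
rewrite addr_ge0 ?dotp_ge0//.
by apply: sumr_ge0 => j _; rewrite -expr2 sqr_ge0.
Qed.

Lemma dotG_le (xi p : carnot R m l) :
  `|dotG xi p| <= (\sum_i `|xi.1 0 i| + \sum_a `|xi.2 0 a|) * enormG p.
Proof.
rewrite /dotG /dotp mulrDl !mulr_suml (le_trans (ler_normD _ _))// lerD//;
  rewrite (le_trans (ler_norm_sum _ _ _))//; apply: ler_sum => i _;
  rewrite normrM ler_wpM2l//; [exact: enormG_coord1|exact: enormG_coord2].
Qed.

Lemma L2normZ (h : R) v : 0 <= h -> L2vec v ->
  L2norm (fun s => h *: v s) = h * L2norm v.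
Proof.
move=> h0 Lv; rewrite /L2norm -/(int01 _) -/(int01 _).
have -> : int01 (fun s => enorm (h *: v s) ^+ 2) =
          h ^+ 2 * int01 (fun s => enorm (v s) ^+ 2).
  rewrite -int01Z; last exact/L2_sqr/L2_enorm.
  apply: eq_int01 => s _; rewrite !enorm_sqr /dotp mulr_sumr.
  by apply: eq_bigr => i _; rewrite !mxE; ring.
by rewrite sqrtrM ?sqr_ge0// sqrtr_sqr ger0_norm.
Qed.

(** Pairing the quadratic expansion of the endpoint with xi leaves h a + h^2 q,
    with a the linear coefficient; Frechet differentiability makes this
    o(h), since xi annihilates the differential, and so a = 0. *)
Lemma frechet_annihilator u dE (xi : carnot R m l) : L2vec u ->
  frechet (endpoint A) u dE ->
  (forall v, L2vec v -> dotG xi (dE v) = 0) ->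
  forall v, L2vec v ->
  dotG xi (pos v 1, vert A (area2 u v + area2 v u)) = 0.
Proof.
move=> Lu [_ _ dF] xi0 v Lv.
set D := (X in dotG xi X); set a := dotG xi D.
pose Q : carnot R m l := (0, vert A (area v)); pose q := dotG xi Q.
pose M := \sum_i `|xi.1 0 i| + \sum_a `|xi.2 0 a|; pose N := L2norm v.
have M0 : 0 <= M by rewrite addr_ge0// sumr_ge0.
have N0 : 0 <= N by exact: sqrtr_ge0.
apply/eqP; rewrite -normr_eq0 eq_le normr_ge0 andbT leNgt; apply/negP => a0.
have MN : 0 < 4 * (M * N + 1) by rewrite mulr_gt0// ltr_wpDl// mulr_ge0.
have [d d0 Hd] := dF (`|a| / (4 * (M * N + 1))) (divr_gt0 a0 MN).
(* h is small enough for the Frechet estimate and for |h q| <= |a| / 4 *)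
pose h := Num.min (d / (N + 1)) (`|a| / (4 * (`|q| + 1))).
have h0 : 0 < h by rewrite lt_min !divr_gt0// ?mulr_gt0// ltr_wpDl.
have hN : h * N <= d.
  have : h * (N + 1) <= d by rewrite -ler_pdivlMr ?ltr_wpDl// ge_min lexx.
  by nra.
have hq : h * `|q| <= `|a| / 4.
  have : h * (4 * (`|q| + 1)) <= `|a|.
    by rewrite -ler_pdivlMr ?mulr_gt0 ?ltr_wpDl// ge_min lexx orbT.
  by lra.
have Lhv := L2vecZ h Lv; have nhv := L2normZ (ltW h0) Lv.
have := Hd _ Lhv; rewrite nhv => /(_ hN).
rewrite !endpointE//; last exact: L2vecD.
rewrite endpDZ// -/D -/Q => est.
have E : dotG xi (endp A u + h *: D + h ^+ 2 *: Q - endp A u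
                  - dE (fun s => h *: v s)) = h * (a + h * q).
  rewrite -[X in _ - X]scale1r -scaleNr dotGDZ xi0// mulr0 addr0.
  rewrite -[X in _ - X]scale1r -scaleNr !dotGDZ /a /q; ring.
have := dotG_le xi (endp A u + h *: D + h ^+ 2 *: Q - endp A u
                  - dE (fun s => h *: v s)).
rewrite E -/M normrM gtr0_norm// => le1.
have le2 : h * `|a + h * q| <= h * (M * (`|a| / (4 * (M * N + 1)) * N)).
  apply: (le_trans le1); apply: (le_trans (ler_wpM2l M0 est)).
  by rewrite le_eqVlt; apply/orP; left; apply/eqP; rewrite /N; ring.
move: le2; rewrite ler_pM2l// => le2.
have le3 : M * (`|a| / (4 * (M * N + 1)) * N) <= `|a| / 4.
  rewrite (_ : _ * _ = (M * N) / (M * N + 1) * (`|a| / 4)); last first.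
    by field; rewrite gt_eqF ?ltr_wpDl// mulr_ge0.
  rewrite ler_piMl ?divr_ge0 ?(ltW a0)// ler_pdivrMr ?ltr_wpDl ?mulr_ge0//.
  by rewrite mul1r lerDl.
have : `|a| <= `|a + h * q| + `|h * q|.
  by rewrite -[X in `|X| <= _](addrK (h * q)) ler_normB.
by rewrite normrM (gtr0_norm h0); lra.
Qed.

(** After integrating by parts, the annihilation condition reads
    int <h, v> = 0 for all v, with h = xi.1 + x(1) K^T / 2 + x K.  Since h is itself an
    admissible variation, h = 0; its value at s = 0 is the constant part, so
    that x K = 0 as well. *)
Lemma abnormal_kernel u : skew_family A -> L2vec u -> abnormal A u ->
  exists2 tau, tau != 0 &
    forall s, 0 <= s <= 1 -> pos u s *m pencil tau = 0.
Proof.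
move=> sA Lu [dE dEu [xi xi0 xidE]].
have ann := frechet_annihilator Lu dEu xidE.
pose tau := xi.2; pose K := pencil tau; have Ks : K^T = - K := pencil_skew tau sA.
pose c : 'rV[R]_m := xi.1 + 2^-1 *: (pos u 1 *m K^T).
pose h (s : R) : 'rV[R]_m := c + pos u s *m K.
have hE s j : h s 0 j = c 0 j + \sum_k K k j * prim (fun r => u r 0 k) s.
  by rewrite !mxE; congr (_ + _); apply: eq_bigr => k _; rewrite mxE mulrC.
have cpr k : L2fun (prim (fun r => u r 0 k)) by exact/L2_bdd/prim_bdd/L2_L1.
have Lh : L2vec h.
  move=> j; have L : L2fun (fun s => c 0 j + \sum_k K k j * prim (fun r => u r 0 k) s).
    apply: L2D; first exact/L2_bdd/bdd_cst.
    by apply: L2sum => k; exact: L2Z.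
  by move: L; congr L2fun; apply/funext => s; rewrite hE.
have key v : L2vec v -> dotG xi (pos v 1, vert A (area2 u v + area2 v u)) =
    \sum_j int01 (fun s => h s 0 j * v s 0 j).
  move=> Lv.
  have -> : \sum_j int01 (fun s => h s 0 j * v s 0 j) =
      dotp c (pos v 1) + mxdot K (area2 u v).
    rewrite /dotp /mxdot exchange_big -big_split/=; apply: eq_bigr => j _.
    rewrite [pos v 1 0 j]mxE prim1 -int01Z; last exact: L2_L1.
    under [X in _ + X]eq_bigr do rewrite mxE.
    have Lk k : L1fun (fun s => K k j * (prim (fun r => u r 0 k) s * v s 0 j)).
      exact/L1Z/L1_prim_mul.
    have Ek k : K k j * int01 (fun s => prim (fun r => u r 0 k) s * v s 0 j) =
        int01 (fun s => K k j * (prim (fun r => u r 0 k) s * v s 0 j)).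
      by rewrite int01Z//; exact: L1_prim_mul.
    under [X in _ + X]eq_bigr do rewrite Ek.
    rewrite -int01_sum// -int01D; [|exact/L1Z/L2_L1|exact: L1sum].
    apply: eq_int01 => s _; rewrite hE mulrDl mulr_suml; congr (_ + _).
    by apply: eq_bigr => k _; ring.
  have E : mxdot K (area2 v u) = mxdot K (area2 u v) - dotp (pos u 1 *m K) (pos v 1).
    rewrite -[area2 v u]trmxK mxdot_skew_tr//.
    have -> : (area2 v u)^T = (pos u 1)^T *m pos v 1 + (-1) *: area2 u v.
      by rewrite -area2_parts// scaleN1r addrAC subrr add0r.
    rewrite mxdotDZr (_ : mxdot K (_ *m _) = dotp (pos u 1 *m K) (pos v 1)); first by ring.
    rewrite /mxdot exchange_big/=; apply: eq_bigr => j _.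
    rewrite [(_ *m K) _ _]mxE mulr_suml; apply: eq_bigr => k _.
    by rewrite !mxE big_ord1 !mxE; ring.
  rewrite /dotG/= dotp_vert -/tau -/K mxdotDr E /c Ks mulmxN.
  rewrite (_ : dotp (_ + _) _ = dotp xi.1 (pos v 1)
             - 2^-1 * dotp (pos u 1 *m K) (pos v 1)); first by field.
  rewrite /dotp mulr_sumr -sumrN -big_split/=; apply: eq_bigr => j _.
  by rewrite !mxE; ring.
have sum0 : \sum_j int01 (fun s => h s 0 j * h s 0 j) = 0.
  by rewrite -key// ann.
have h0 s : 0 <= s <= 1 -> h s = 0.
  move=> s01; apply/rowP => j; rewrite [RHS]mxE.
  have i0 i : 0 <= int01 (fun s => h s 0 i * h s 0 i).
    by apply: int01_ge0 => r _; rewrite -expr2 sqr_ge0.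
  have ij : int01 (fun s => h s 0 j * h s 0 j) = 0.
    by move/eqP: sum0; rewrite psumr_eq0// => /allP/(_ j (mem_index_enum _))/eqP.
  have LK : L1fun (fun r => \sum_k K k j * u r 0 k).
    by apply: L1sum => k; exact/L1Z/L2_L1.
  have hp r : h r 0 j = c 0 j + prim (fun r => \sum_k K k j * u r 0 k) r.
    rewrite hE prim_sum; last by move=> k; exact/L1Z/L2_L1.
    by congr (_ + _); apply: eq_bigr => k _; rewrite primZ//; exact: L2_L1.
  apply: (cont_int01_sqr_eq0 _ ij s01).
  rewrite (_ : (fun s => _) = fun s => c 0 j + prim (fun r => \sum_k K k j * u r 0 k) s).
    apply: within_continuousD; last exact: prim_within.
    by apply: continuous_subspaceT => r; exact: cvg_cst.
  by apply/funext.
have c0 : c = 0.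
  have := h0 0; rewrite lexx ler01 => /(_ isT) <-; rewrite /h.
  rewrite (_ : pos u 0 = 0) ?mul0mx ?addr0//.
  by apply/rowP => j; rewrite !mxE prim0.
exists tau; last by move=> s /h0; rewrite /h c0 add0r.
apply/eqP => tau0; apply: xi0; rewrite [xi]surjective_pairing -/tau tau0.
congr pair; move: c0; rewrite /c /K tau0.
by rewrite /pencil big1 ?trmx0 ?mulmx0 ?scaler0 ?addr0// => a _; rewrite mxE scale0r.
Qed.

End Abnormal.

(** * Skew-symmetric matrices and freeness *)

Section LinearAlgebra.
Variable R : realType.

Lemma dotpE m (x y : 'rV[R]_m) : dotp x y = (x *m y^T) 0 0.
Proof. by rewrite mxE; apply: eq_bigr => i _; rewrite mxE. Qed.

Lemma dotp_eq0 m (x : 'rV[R]_m) : dotp x x = 0 -> x = 0.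
Proof.
move=> /eqP; rewrite psumr_eq0 => [/allP x0|i _]; last by rewrite -expr2 sqr_ge0.
apply/rowP => i; rewrite mxE; apply/eqP.
by have := x0 i (mem_index_enum _); rewrite mulf_eq0 orbb.
Qed.

(** For skew-symmetric K the row space is the orthogonal complement of the
    kernel, so the projection onto the kernel parallel to it is symmetric. *)
Lemma kernel_projection m (K : 'M[R]_m) : K^T = - K ->
  exists P : 'M[R]_m, [/\ P^T = P, P *m P = P, P *m K = 0
    & forall x : 'rV[R]_m, x *m K = 0 -> x *m P = x].
Proof.
move=> Ks; have cap0 : (kermx K :&: K)%MS = 0.
  apply/eqP/rowV0P => u; rewrite sub_capmx => /andP[/sub_kermxP uK /submxP[D uE]].
  apply: dotp_eq0; rewrite dotpE {1}uE -mulmxA.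
  have -> : K *m u^T = - (u *m K)^T by rewrite trmx_mul Ks mulNmx opprK.
  by rewrite uK trmx0 oppr0 mulmx0 mxE.
have full : (1%:M <= kermx K + K)%MS.
  rewrite sub1mx /row_full mxrank_disjoint_sum// mxrank_ker subnK//.
  exact: rank_leq_row.
pose P := proj_mx (kermx K) K.
have PK : P *m K = 0 by apply/sub_kermxP; rewrite -[P]mul1mx proj_mx_sub.
have /submxP[E PE] : (1%:M - P <= K)%MS.
  by rewrite -[P]mul1mx proj_mx_compl_sub.
have PPT : P = P *m P^T.
  have : P *m (1%:M - P)^T = 0.
    by rewrite PE trmx_mul Ks mulmxA mulmxN PK oppr0 mul0mx.
  by rewrite raddfB/= trmx1 mulmxBr mulmx1 => /eqP; rewrite subr_eq0 => /eqP.
have PT : P^T = P by rewrite {1}PPT trmx_mul trmxK -PPT.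
exists P; split => //; first by rewrite -{2}PT -PPT.
by move=> x xK; apply: proj_mx_id => //; exact/sub_kermxP.
Qed.

Lemma free_map_sum (T : eqType) (vT : vectType R) (f : T -> vT) (s : seq T)
    (g : T -> R) : free (map f s) -> \sum_(x <- s) g x *: f x = 0 ->
  forall x, x \in s -> g x = 0.
Proof.
elim: s => [//|a s IH]; rewrite /= free_cons big_cons => /andP[fa fs] sum0.
have ga : g a = 0.
  apply/eqP; apply: contraNT fa => ga.
  have -> : f a = - (g a)^-1 *: \sum_(x <- s) g x *: f x.
    move/eqP: sum0; rewrite addrC addr_eq0 => /eqP ->.
    by rewrite scalerN scaleNr opprK scalerA mulVf// scale1r.
  rewrite memvZ// big_seq memv_suml// => x xs.
  by rewrite memvZ// memv_span// map_f.
move=> x; rewrite inE => /predU1P[->//|xs]; apply: IH => //.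
by move: sum0; rewrite ga scale0r add0r.
Qed.

Lemma card_lt_pairs m : #|[pred jk : 'I_m * 'I_m | (jk.1 < jk.2)%N]| = (m * m.-1)./2.
Proof.
rewrite -bin2 -bin2_sum -sum1_card big_mkord.
transitivity (\sum_(i < m) \sum_(j < m | (i < j)%N) 1)%N.
  by rewrite pair_big_dep.
rewrite (exchange_big_dep xpredT)//=; apply: eq_bigr => j _.
by rewrite -(big_ord_widen m (fun=> 1%N) (ltnW (ltn_ord j))) sum1_card card_ord.
Qed.

Lemma sum_lt_pairs m (F : 'I_m -> 'I_m -> R) :
  (forall k j, F k j = F j k) -> (forall k, F k k = 0) ->
  \sum_k \sum_j F k j = 2 * \sum_(jk : 'I_m * 'I_m | (jk.1 < jk.2)%N) F jk.1 jk.2.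
Proof.
move=> Fs F0; rewrite pair_bigA (bigID (fun p : 'I_m * 'I_m => (p.1 < p.2)%N))/=.
rewrite [X in _ + X](bigID (fun p : 'I_m * 'I_m => (p.2 < p.1)%N))/=.
rewrite [X in _ + (_ + X)]big1 ?addr0; last first.
  move=> [k j] /=; rewrite -!leqNgt => /andP[jk kj].
  suff -> : k = j by exact: F0.
  by apply/val_inj/eqP; rewrite eqn_leq kj jk.
rewrite mulr_natl mulr2n; congr (_ + _).
rewrite [RHS](reindex_inj (can_inj swap_pairK))/=.
symmetry; apply: eq_big => [p|p _]; last exact: Fs.
by rewrite /= -leqNgt andb_idl// => /ltnW.
Qed.

Variables (m l : nat) (A : 'I_l -> 'M[R]_m).

Lemma pencil_eq0 tau : hormander A -> pencil A tau = 0 -> tau = 0.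
Proof.
move=> hA K0; apply: dotp_eq0.
have : tau \in fullv by exact: memvf.
rewrite -hA; set X := [seq _ | _ <- _] => /(coord_span (X := in_tuple X)) {2}->.
rewrite dotpE raddf_sum/= mulmx_sumr summxE big1// => i _.
rewrite linearZ/= -scalemxAr mxE -dotpE.
have /mapP[jk _ ->] : X`_i \in X by rewrite mem_nth.
have -> : dotp tau (\row_a A a jk.1 jk.2) = pencil A tau jk.1 jk.2.
  by rewrite pencilE; apply: eq_bigr => a _; rewrite mxE.
by rewrite K0 mxE mulr0.
Qed.

(** For skew-symmetric Z the vertical coordinate is the combination of the
    generating vectors of the Hormander condition with coefficients Z_jk. *)
Lemma vert_lt_pairs (Z : 'M[R]_m) : skew_family A -> Z^T = - Z ->
  vert A Z = \sum_(jk : 'I_m * 'I_m | (jk.1 < jk.2)%N)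
               Z jk.1 jk.2 *: \row_a A a jk.1 jk.2.
Proof.
move=> sA Zs; apply/rowP => a; rewrite mxE summxE.
have skE (B : 'M[R]_m) k j : B^T = - B -> B k j = - B j k.
  by move/matrixP/(_ j k); rewrite !mxE.
rewrite sum_lt_pairs => [|k j|k]; last 2 first.
- by rewrite (skE (A a))// (skE Z)// mulrNN.
- by have := skE Z k k Zs; nra.
rewrite mulKf ?pnatr_eq0//; apply: eq_bigr => jk _.
by rewrite !mxE mulrC.
Qed.

(** In the free case the generating vectors are m(m-1)/2 = l in number and span
    a space of dimension l: they are linearly independent. *)
Lemma vert_inj_skew (Z : 'M[R]_m) : skew_family A -> hormander A ->
  free_step_two m l -> Z^T = - Z -> vert A Z = 0 -> Z = 0.
Proof.
move=> sA hA ml Zs; rewrite vert_lt_pairs//.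
set f := fun jk : 'I_m * 'I_m => \row_a A a jk.1 jk.2.
have fr : free [seq f jk | jk <- enum [pred jk : 'I_m * 'I_m | (jk.1 < jk.2)%N]].
  rewrite /free hA dimvf size_map -cardE card_lt_pairs -ml.
  by rewrite /dim/= mul1n.
rewrite -big_enum/= => /(free_map_sum fr) Z0.
have Zlt (k j : 'I_m) : (k < j)%N -> Z k j = 0.
  by move=> kj; apply: (Z0 (k, j)); rewrite mem_enum.
have Zsk (k j : 'I_m) : Z k j = - Z j k.
  by move/matrixP/(_ j k): Zs; rewrite !mxE.
apply/matrixP => k j; rewrite mxE; case: (ltngtP k j) => kj.
- exact: Zlt.
- by rewrite Zsk Zlt// oppr0.
- have -> : k = j by exact: val_inj.
  by have := Zsk j j; lra.
Qed.

End LinearAlgebra.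

(** * Length and area of projected controls *)

Section Lengths.
Variables (R : realType) (m : nat).
Implicit Types (u w : R -> 'rV[R]_m) (B K P : 'M[R]_m).

Lemma L2vec_mul u B : L2vec u -> L2vec (fun s => u s *m B).
Proof.
move=> Lu j; have L : L2fun (fun s => \sum_i B i j * u s 0 i).
  by apply: L2sum => i; exact: L2Z.
move: L; congr L2fun; apply/funext => s.
by rewrite mxE; apply: eq_bigr => i _; rewrite mulrC.
Qed.

Lemma pos_mul u B s : L2vec u -> pos (fun s => u s *m B) s = pos u s *m B.
Proof.
move=> Lu; apply/rowP => j; rewrite !mxE.
have LB i : L1fun (fun s => B i j * u s 0 i) by exact/L1Z/L2_L1.
transitivity (prim (fun s => \sum_i B i j * u s 0 i) s).
  by apply: eq_prim => r _; rewrite mxE; apply: eq_bigr => i _; rewrite mulrC.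
rewrite prim_sum//; apply: eq_bigr => i _.
by rewrite primZ; [rewrite mxE mulrC|exact: L2_L1].
Qed.

Lemma area_mul u B : L2vec u -> area (fun s => u s *m B) = B^T *m area u *m B.
Proof.
move=> Lu; apply/matrixP => k j; rewrite !mxE.
have L i i' : L1fun (fun s => B i' j * (B i k * (prim (fun r => u r 0 i) s * u s 0 i'))).
  by apply/L1Z/L1Z/L1_prim_mul.
transitivity (int01 (fun s => \sum_i' \sum_i
    B i' j * (B i k * (prim (fun r => u r 0 i) s * u s 0 i')))).
  apply: eq_int01 => s _; have /rowP/(_ k) := pos_mul B s Lu.
  rewrite !mxE => ->; rewrite mulr_sumr; apply: eq_bigr => i' _.
  rewrite mulr_suml; apply: eq_bigr => i _; rewrite mxE; ring.
rewrite int01_sum; last by move=> i'; exact: L1sum.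
apply: eq_bigr => i' _; rewrite int01_sum// !mxE mulr_suml.
apply: eq_bigr => i _.
rewrite int01Z; last exact/L1Z/L1_prim_mul.
rewrite int01Z; last exact: L1_prim_mul.
by rewrite !mxE; ring.
Qed.

Lemma enorm_pythagoras P (x : 'rV[R]_m) : P^T = P -> P *m P = P ->
  enorm x ^+ 2 = enorm (x *m P) ^+ 2 + enorm (x *m (1%:M - P)) ^+ 2.
Proof.
move=> PT PP; have QT : (1%:M - P)^T = 1%:M - P by rewrite raddfB/= trmx1 PT.
rewrite !enorm_sqr !dotpE !trmx_mul QT PT.
rewrite !mulmxA -[x *m P *m P]mulmxA PP -[x *m (1%:M - P) *m (1%:M - P)]mulmxA.
rewrite (_ : (1%:M - P) *m (1%:M - P) = 1%:M - P); last first.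
  by rewrite mulmxBl mul1mx mulmxBr mulmx1 PP subrr subr0.
by rewrite mulmxBr mulmx1 mulmxBl !mxE addrCA subrr addr0.
Qed.

(** With N = sqrt (a^2 + b^2), the Cauchy-Schwarz inequality gives
    a |wP| + b |w(1-P)| <= N |w| pointwise; integrate. *)
Lemma length_pythagoras P w : P^T = P -> P *m P = P -> L2vec w ->
  Num.sqrt (int01 (fun s => enorm (w s *m P)) ^+ 2 +
            int01 (fun s => enorm (w s *m (1%:M - P))) ^+ 2)
  <= int01 (fun s => enorm (w s)).
Proof.
move=> PT PP Lw.
have LE B : L1fun (fun s => enorm (w s *m B)) by exact/L2_L1/L2_enorm/L2vec_mul.
have Ln : L1fun (fun s => enorm (w s)) by exact/L2_L1/L2_enorm.
set a := int01 (fun s => enorm (w s *m P)).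
set b := int01 (fun s => enorm (w s *m _)); set L := int01 _.
have L0 : 0 <= L by apply: int01_ge0 => s _; exact: enorm_ge0.
set N := Num.sqrt _; have N0 : 0 <= N by exact: sqrtr_ge0.
have N2 : N ^+ 2 = a ^+ 2 + b ^+ 2 by rewrite sqr_sqrtr// addr_ge0// sqr_ge0.
have : a * a + b * b <= N * L.
  rewrite -!int01Z// -int01D; [|exact: L1Z|exact: L1Z].
  apply: int01_le; [by apply: L1D; exact: L1Z|exact: L1Z|move=> s _].
  have := enorm_pythagoras (w s) PT PP.
  have := enorm_ge0 (w s).
  set x := enorm (w s); set p := enorm (_ *m P); set q := enorm (_ *m _).
  move=> x0 xpq.
  have : (a * p + b * q) ^+ 2 <= (N * x) ^+ 2.
    rewrite [leRHS]exprMn N2 xpq -subr_ge0.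
    rewrite (_ : _ - _ = (a * q - b * p) ^+ 2) ?sqr_ge0//; ring.
  move=> /(le_trans _) h; apply: (le_trans (ler_norm _)).
  by rewrite -(ler_pXn2r (ltn0Sn 1)) ?nnegrE ?mulr_ge0// real_normK ?num_real// h.
rewrite -!expr2 -N2 expr2; move: N0; rewrite le_eqVlt => /predU1P[<-//|N0].
by rewrite ler_pM2l.
Qed.

Lemma area_le u k j : L2vec u ->
  `|area u k j| <= int01 (fun s => enorm (u s)) ^+ 2.
Proof.
move=> Lu; rewrite mxE; set b := int01 (fun s => enorm (u s)).
have Ln : L1fun (fun s => enorm (u s)) by exact/L2_L1/L2_enorm.
have Lj i : L1fun (fun s => u s 0 i) by exact: L2_L1.
have bj i : int01 (fun s => `|u s 0 i|) <= b.
  apply: int01_le; [exact/L1norm/Lj|exact: Ln|move=> s _; exact: coord_le_enorm].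
have b0 : 0 <= b by apply: int01_ge0 => s _; exact: enorm_ge0.
have Lp : L1fun (fun s => prim (fun r => u r 0 k) s * u s 0 j) by exact: L1_prim_mul.
apply: (le_trans (le_norm_int01 Lp)).
apply: (@le_trans _ _ (int01 (fun s => b * `|u s 0 j|))).
  apply: int01_le; [exact: L1norm|exact/L1Z/L1norm|move=> s _].
  by rewrite normrM ler_wpM2r// (le_trans (prim_norm_le _ _)).
by rewrite int01Z ?expr2 ?ler_wpM2l//; exact: L1norm.
Qed.

Lemma mxdot_mul K B Z : mxdot K (B^T *m Z *m B) = mxdot (B *m K *m B^T) Z.
Proof.
have E (X Y : 'M[R]_m) : mxdot X Y = \tr (X^T *m Y).
  rewrite /mxdot exchange_big; apply: eq_bigr => j _; rewrite mxE.
  by apply: eq_bigr => k _; rewrite mxE.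
by rewrite !E !trmx_mul trmxK !mulmxA mxtrace_mulC !mulmxA.
Qed.

(** The bound by 1 absorbs the term in beta^2, and the other one satisfies
    C (2 D + 1) <= kappa / (|K|_1 + 1). *)
Definition growth_rate K (D kappa : R) : R :=
  Num.min 1 (kappa / ((\sum_k \sum_j `|K k j| + 1) * (2 * D + 1))).

Lemma growth_rate_gt0 K D kappa : 0 <= D -> 0 < kappa -> 0 < growth_rate K D kappa.
Proof.
move=> D0 k0; rewrite lt_min ltr01 divr_gt0// mulr_gt0// ltr_wpDl ?mulr_ge0//.
by apply: sumr_ge0 => k _; apply: sumr_ge0.
Qed.

(** The component of w orthogonal to the kernel has length b with
    |beta| kappa <= |K|_1 b^2, and |beta| <= 1 turns the resulting
    sqrt (D^2 + c |beta|) into a linear lower bound. *)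
Lemma length_growth P K w D kappa beta :
  P^T = P -> P *m P = P -> P *m K = 0 -> K^T = - K -> L2vec w ->
  0 <= D <= int01 (fun s => enorm (w s *m P)) ->
  0 < kappa -> mxdot K (area w) = beta * kappa -> `|beta| <= 1 ->
  D + growth_rate K D kappa * `|beta| <= int01 (fun s => enorm (w s)).
Proof.
move=> PT PP PK Ks Lw /andP[D0 Da] k0 Kw b1.
pose Q := 1%:M - P.
have QT : Q^T = Q by rewrite raddfB/= trmx1 PT.
have KP : K *m P = 0.
  by rewrite -[K]trmxK Ks -{1}PT -trmx_mul mulmxN PK oppr0 trmx0.
have QKQ : Q *m K *m Q^T = K.
  by rewrite QT mulmxBl mul1mx PK subr0 mulmxBr mulmx1 KP subr0.
set b := int01 (fun s => enorm (w s *m Q)).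
have b2 : `|beta| * kappa <= (\sum_k \sum_j `|K k j|) * b ^+ 2.
  rewrite -(gtr0_norm k0) -normrM -Kw -QKQ -mxdot_mul -area_mul// QKQ.
  rewrite /mxdot mulr_suml (le_trans (ler_norm_sum _ _ _))//; apply: ler_sum => k _.
  rewrite mulr_suml (le_trans (ler_norm_sum _ _ _))//; apply: ler_sum => j _.
  by rewrite normrM ler_wpM2l// area_le//; exact: L2vec_mul.
apply: le_trans (length_pythagoras PT PP Lw); rewrite -/Q -/b.
move: Da; set a := int01 _ => Da.
set C := growth_rate _ _ _; have C0 : 0 < C by exact: growth_rate_gt0.
have C1 : C <= 1 by rewrite ge_min lexx.
move: b2; set S := (\sum_k _) => b2.
have S0 : 0 <= S by apply: sumr_ge0 => k _; apply: sumr_ge0.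
have CS : C * ((S + 1) * (2 * D + 1)) <= kappa.
  by rewrite -ler_pdivlMr ?ge_min ?lexx ?orbT// mulr_gt0// ltr_wpDl// mulr_ge0.
have bb : 0 <= `|beta| := normr_ge0 beta.
have est : (2 * D + 1) * C * `|beta| <= b ^+ 2.
  have : (S + 1) * ((2 * D + 1) * C * `|beta|) <= (S + 1) * b ^+ 2.
    apply: (@le_trans _ _ (`|beta| * kappa)).
      rewrite (_ : _ * _ = `|beta| * (C * ((S + 1) * (2 * D + 1)))); last by ring.
      exact: ler_wpM2l.
    by rewrite (le_trans b2)// ler_wpM2r ?sqr_ge0// lerDl.
  by rewrite ler_pM2l// ltr_wpDl.
have sq : (D + C * `|beta|) ^+ 2 <= a ^+ 2 + b ^+ 2.
  have D2 : D ^+ 2 <= a ^+ 2 by rewrite ler_pXn2r ?nnegrE// (le_trans D0).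
  have CC : (C * `|beta|) * (C * `|beta|) <= C * `|beta| * 1.
    by rewrite ler_wpM2l ?mulr_ge0 ?(ltW C0)// mulr_ile1// ltW.
  rewrite sqrrD (_ : _ *+ 2 = 2 * D * (C * `|beta|)); last by ring.
  by rewrite expr2; move: est CC D2; rewrite !expr2; lra.
rewrite -(ler_pXn2r (ltn0Sn 1)) ?nnegrE ?sqrtr_ge0 ?addr_ge0 ?mulr_ge0 ?(ltW C0)//.
by rewrite sqr_sqrtr// addr_ge0// sqr_ge0.
Qed.

End Lengths.

(** * Growth of the distance *)

Section Growth.
Variables (R : realType) (m l : nat) (A : 'I_l -> 'M[R]_m).
Hypothesis A_skew : skew_family A.
Implicit Types (u w : R -> 'rV[R]_m) (B K P Z : 'M[R]_m).

Lemma vert_tr Z : vert A Z^T = - vert A Z.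
Proof.
apply/rowP => a; rewrite !mxE -mulrN; congr (_ * _).
exact: (mxdot_skew_tr _ (A_skew a)).
Qed.

Lemma cauchy_schwarz (x y : 'rV[R]_m) : dotp x y <= enorm x * enorm y.
Proof.
have x0 := enorm_ge0 x; have y0 := enorm_ge0 y.
have z0 (z : 'rV[R]_m) : enorm z = 0 -> z = 0.
  by move=> nz; apply: dotp_eq0; rewrite -enorm_sqr nz expr0n.
have [/z0 ->|xn0] := eqVneq (enorm x) 0.
  by rewrite /dotp big1 ?mulr_ge0 ?enorm_ge0// => i _; rewrite mxE mul0r.
have [/z0 ->|yn0] := eqVneq (enorm y) 0.
  by rewrite /dotp big1 ?mulr_ge0 ?enorm_ge0// => i _; rewrite mxE mulr0.
have expand (a b : R) : dotp (b *: x - a *: y) (b *: x - a *: y) =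
    b ^+ 2 * dotp x x - 2 * (a * b) * dotp x y + a ^+ 2 * dotp y y.
  rewrite /dotp !mulr_sumr -sumrN -!big_split/=.
  by apply: eq_bigr => i _; rewrite !mxE; ring.
have := dotp_ge0 (enorm y *: x - enorm x *: y).
rewrite expand -!enorm_sqr (_ : _ + _ =
  2 * (enorm x * enorm y) * (enorm x * enorm y - dotp x y)); last by ring.
rewrite pmulr_rge0 ?subr_ge0// !mulr_gt0// lt0r ?xn0 ?yn0 ?x0 ?y0//.
Qed.

(** A chord is not longer than its curve: pair the control with the endpoint. *)
Lemma enorm_pos_le u : L2vec u ->
  enorm (pos u 1) <= int01 (fun s => enorm (u s)).
Proof.
move=> Lu; set x := pos u 1.
have Ln : L1fun (fun s => enorm (u s)) by exact/L2_L1/L2_enorm.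
have : enorm x * enorm x <= enorm x * int01 (fun s => enorm (u s)).
  rewrite -int01Z// -expr2 enorm_sqr.
  have -> : dotp x x = int01 (fun s => dotp x (u s)).
    rewrite int01_sum; last by move=> i; exact/L1Z/L2_L1.
    by apply: eq_bigr => i _; rewrite int01Z ?[in X in _ * X]mxE ?prim1//; exact: L2_L1.
  apply: int01_le; [|exact: L1Z|by move=> s _; exact: cauchy_schwarz].
  by apply: L1sum => i; exact/L1Z/L2_L1.
have := enorm_ge0 x; rewrite le_eqVlt => /predU1P[<- _|x0].
  by apply: int01_ge0 => s _; exact: enorm_ge0.
by rewrite ler_pM2l.
Qed.

(** The segment from 0 to x has a symmetric area matrix, hence no vertical
    displacement. *)
Lemma dist_horizontal_le (x : 'rV[R]_m) : (cc_dist0 A (x, 0)%R <= (enorm x)%:E)%E.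
Proof.
pose w (s : R) := x.
have Lw : L2vec w by move=> j; exact/L2_bdd/bdd_cst.
have prx k s : prim (fun=> x 0 k) s = x 0 k * prim (fun=> 1) s.
  rewrite -primZ; last exact: L1cst.
  by apply: eq_prim => r _; rewrite mulr1.
have Ew : endp A w = (x, 0).
  congr pair; first by apply/rowP => j; rewrite mxE prim1 int01_cst.
  have sy : (area w)^T = area w.
    by apply/matrixP => k j; rewrite !mxE; apply: eq_int01 => s _; rewrite !prx; ring.
  have := vert_tr (area w); rewrite sy => /eqP.
  by rewrite -addr_eq0 -mulr2n -scaler_nat scaler_eq0 pnatr_eq0 => /eqP.
by have := cc_dist0_le A Lw; rewrite Ew path_lengthE// /w int01_cst.
Qed.

Lemma kernel_area u K : L2vec u -> (forall s, 0 <= s <= 1 -> pos u s *m K = 0) ->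
  mxdot K (area u) = 0.
Proof.
move=> Lu uK; rewrite /mxdot.
have L k j : L1fun (fun s => K k j * (prim (fun r => u r 0 k) s * u s 0 j)).
  exact/L1Z/L1_prim_mul.
transitivity (int01 (fun s => \sum_k \sum_j
    K k j * (prim (fun r => u r 0 k) s * u s 0 j))).
  rewrite int01_sum; last by move=> k; exact: L1sum.
  apply: eq_bigr => k _; rewrite int01_sum//; apply: eq_bigr => j _.
  by rewrite mxE int01Z//; exact: L1_prim_mul.
rewrite -[RHS](int01_cst 0); apply: eq_int01 => s /andP[s0 s1].
rewrite exchange_big big1// => j _ /=.
have /rowP/(_ j) : pos u s *m K = 0 by rewrite uK// !ltW.
rewrite !mxE => xKj; transitivity ((\sum_i pos u s 0 i * K i j) * u s 0 j).
  by rewrite mulr_suml; apply: eq_bigr => i _; rewrite mxE; ring.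
by rewrite xKj mul0r.
Qed.

(** Freeness recovers the antisymmetric part of the area matrix of w as that of
    u plus 2 beta K.  Conjugation by P kills K, and fixes the area matrix
    of u up to symmetric terms because P fixes its path. *)
Lemma endp_projection u P K w (beta : R) :
  hormander A -> free_step_two m l -> L2vec u -> L2vec w ->
  P^T = P -> P *m K = 0 -> K^T = - K ->
  (forall s, 0 <= s <= 1 -> pos u s *m P = pos u s) ->
  endp A w = ((endp A u).1, (endp A u).2 + beta *: vert A K) ->
  endp A (fun s => w s *m P) = endp A u.
Proof.
move=> hA hfree Lu Lw PT PK Ks uP [w1 w2].
have one01 : 0 <= (1 : R) <= 1 by rewrite ler01 lexx.
congr pair; first by rewrite pos_mul// w1 uP.
rewrite area_mul// PT.
(* twice the antisymmetric part *)
pose alt Z : 'M[R]_m := Z + (-1) *: Z^T.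
have vert_alt Z : vert A (alt Z) = 2 *: vert A Z.
  by rewrite vertDZ vert_tr scaleN1r opprK scaler_nat mulr2n.
have alt_skew Z : (alt Z)^T = - alt Z.
  by rewrite /alt linearD/= linearZ/= trmxK !scaleN1r opprB addrC.
have skewDZ X Y c : X^T = - X -> Y^T = - Y -> (X + c *: Y)^T = - (X + c *: Y) :> 'M[R]_m.
  by move=> Xs Ys; rewrite linearD/= linearZ/= Xs Ys scalerN opprD.
have altw : alt (area w) = alt (area u) + (2 * beta) *: K.
  apply/eqP; rewrite -subr_eq0 -scaleN1r; apply/eqP.
  apply: (vert_inj_skew A_skew) => //.
    by rewrite skewDZ// skewDZ.
  rewrite vertDZ [X in _ *: X]vertDZ !vert_alt w2 scaleN1r scalerDr scalerA.
  by rewrite subrr.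
(* P moves onto the path inside the integral; only the path is known to be
   fixed by P everywhere, so that the transpose is reached by parts *)
have Pu : P *m area u = area u.
  apply/matrixP => k j; rewrite !mxE.
  have L i : L1fun (fun s => P k i * (prim (fun r => u r 0 i) s * u s 0 j)).
    exact/L1Z/L1_prim_mul.
  transitivity (int01 (fun s => \sum_i P k i * (prim (fun r => u r 0 i) s * u s 0 j))).
    rewrite int01_sum//; apply: eq_bigr => i _.
    by rewrite mxE int01Z//; exact: L1_prim_mul.
  apply: eq_int01 => s /andP[s0 s1].
  have /rowP/(_ k) : pos u s *m P = pos u s by rewrite uP// !ltW.
  rewrite !mxE => <-; rewrite mulr_suml; apply: eq_bigr => i _.
  by rewrite mxE -[in LHS]PT mxE; ring.
have PuT : P *m (area u)^T = (area u)^T.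
  have -> : (area u)^T = (pos u 1)^T *m pos u 1 - area u.
    by rewrite -(area2_parts Lu Lu) addrAC subrr add0r.
  by rewrite mulmxBr Pu mulmxA -{1}PT -trmx_mul uP.
have Palt : P *m alt (area u) = alt (area u).
  by rewrite mulmxDr -scalemxAr Pu PuT.
have altP : alt (area u) *m P = alt (area u).
  by rewrite -[LHS]trmxK trmx_mul PT alt_skew mulmxN Palt -alt_skew trmxK.
have alt_mul : alt (P *m area w *m P) = P *m alt (area w) *m P.
  by rewrite /alt !trmx_mul PT mulmxDr mulmxDl -scalemxAr -scalemxAl !mulmxA.
have : 2 *: vert A (P *m area w *m P) = 2 *: vert A (area u).
  by rewrite -!vert_alt alt_mul altw mulmxDr mulmxDl -scalemxAr PK scaler0 mul0mx
             addr0 Palt altP.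
by move/(scalerI _); apply; rewrite pnatr_eq0.
Qed.

(** What the two parts of the theorem share: only the reason why projecting a
    competitor to the kernel of K keeps it at least as long as D differs. *)
Lemma distance_growth tau P (x : 'rV[R]_m) (t : 'rV[R]_l) (D : R) :
  hormander A -> tau != 0 ->
  P^T = P -> P *m P = P -> P *m pencil A tau = 0 ->
  dotp tau t = 0 -> 0 <= D -> cc_dist0 A (x, t) = D%:E ->
  (forall w beta, L2vec w ->
     endp A w = (x, t + beta *: vert A (pencil A tau)) ->
     D <= int01 (fun s => enorm (w s *m P))) ->
  exists (C : R) (sigma : 'rV[R]_l), 0 < C /\
    forall beta : R, -1 <= beta <= 1 ->
      ((C * `|beta|)%:E
        <= cc_dist0 A (x, t + beta *: sigma)%R - cc_dist0 A (x, t)%R)%E.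
Proof.
move=> hA tau0 PT PP PK taut D0 dD proj.
set K := pencil A tau in PK proj *.
have Ks : K^T = - K := pencil_skew tau A_skew.
pose kappa := mxdot K K.
have sq0 k : 0 <= \sum_j K k j * K k j.
  by apply: sumr_ge0 => j _; rewrite -expr2 sqr_ge0.
have kappa0 : 0 < kappa.
  rewrite lt0r sumr_ge0// andbT; apply: contraNN tau0 => /eqP K0.
  apply/eqP/(pencil_eq0 hA)/matrixP => k j; rewrite [RHS]mxE -/K.
  have := K0 => /eqP; rewrite psumr_eq0// => /allP/(_ k (mem_index_enum _))/=.
  rewrite psumr_eq0 => [|i _]; last by rewrite -expr2 sqr_ge0.
  move=> /allP/(_ j (mem_index_enum _))/=.
  by rewrite mulf_eq0 orbb => /eqP.
exists (growth_rate K D kappa), (vert A K); split; first exact: growth_rate_gt0.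
move=> beta; rewrite -ler_norml => beta1.
have : ((D + growth_rate K D kappa * `|beta|)%:E <=
        cc_dist0 A (x, t + beta *: vert A K)%R)%E.
  apply: cc_dist0_ge => w Lw Ew; rewrite path_lengthE// lee_fin.
  apply: (length_growth PT PP PK Ks Lw) => //.
    by rewrite D0 (proj w beta).
  have := dotp_vert A tau (area w); rewrite -/K.
  rewrite (_ : vert A (area w) = t + beta *: vert A K); last by case: Ew.
  rewrite (_ : dotp tau _ = dotp tau t + beta * dotp tau (vert A K)); last first.
    by rewrite /dotp mulr_sumr -big_split/=; apply: eq_bigr => a _; rewrite !mxE; ring.
  by rewrite taut add0r dotp_vert -/K -/kappa; lra.
rewrite dD; case: (cc_dist0 A _) => [r| |].
- by rewrite -EFinB !lee_fin; lra.
- by move=> _; rewrite addye// leey.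
- by rewrite leeNy_eq.
Qed.

End Growth.

Theorem theorem1p1 (R : realType) (m l : nat) (A : 'I_l -> 'M[R]_m)
    (A_skew : skew_family A) (A_hormander : hormander A) :
  (forall (x : 'rV[R]_m) (gamma : R -> carnot R m l),
     abnormal_minimizer_from_origin A gamma -> gamma 1 = (x, 0) ->
     exists (C : R) (tau : 'rV[R]_l), 0 < C /\
       forall beta : R, -1 <= beta <= 1 ->
         ((C * `|beta|)%:E
           <= cc_dist0 A (x, beta *: tau)%R - cc_dist0 A (x, 0)%R)%E)
  /\
  (free_step_two m l ->
   forall (x : 'rV[R]_m) (t : 'rV[R]_l) (gamma : R -> carnot R m l),
     abnormal_minimizer_from_origin A gamma -> gamma 1 = (x, t) ->
     exists (C : R) (tau : 'rV[R]_l), 0 < C /\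
       forall beta : R, -1 <= beta <= 1 ->
         ((C * `|beta|)%:E
           <= cc_dist0 A (x, t + beta *: tau)%R - cc_dist0 A (x, t)%R)%E).
Proof.
have setup (x : 'rV[R]_m) t (gamma : R -> carnot R m l) :
    abnormal_minimizer_from_origin A gamma -> gamma 1 = (x, t) ->
  exists u (tau : 'rV[R]_l) P (D : R), [/\ L2vec u, endp A u = (x, t), tau != 0,
    [/\ P^T = P, P *m P = P, P *m pencil A tau = 0 &
       forall s, 0 <= s <= 1 -> pos u s *m P = pos u s] &
    [/\ dotp tau t = 0, 0 <= D & cc_dist0 A (x, t) = D%:E]].
  move=> [g0 [u [hg len ab]]] g1; have Lu : L2vec u by case: hg.
  have [tau tau0 uK] := abnormal_kernel A_skew Lu ab.
  have [P [PT PP PK Pid]] := kernel_projection (pencil_skew tau A_skew).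
  have Eu : endp A u = (x, t).
    by rewrite -path_of1 -(horizontal_path_of hg g0) ?lexx ?ler01.
  exists u, tau, P, (int01 (fun s => enorm (u s))); split => //.
    by split => // s s01; rewrite Pid// uK.
  split; last by rewrite -path_lengthE// len g0 g1.
    rewrite (_ : t = vert A (area u)); last by case: Eu.
    by rewrite dotp_vert kernel_area// mulr0.
  by apply: int01_ge0 => s _; exact: enorm_ge0.
have one01 : 0 <= (1 : R) <= 1 by rewrite ler01 lexx.
split=> [x gamma ab g1|hfree x t gamma ab g1].
  have [u [tau [P [D [Lu Eu tau0 [PT PP PK uP] [taut D0 dD]]]]]] := setup _ _ _ ab g1.
  have [|C [sigma [C0 Cb]]] := distance_growth A_skew A_hormander tau0 PT PP PK taut D0 dD.
    move=> w beta Lw [w1 _]; rewrite -lee_fin -dD.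
    apply: (le_trans (dist_horizontal_le A_skew x)); rewrite lee_fin.
    have <- : pos (fun s => w s *m P) 1 = x.
      by rewrite pos_mul// w1; case: Eu => <- _; exact: uP.
    exact/enorm_pos_le/L2vec_mul.
  exists C, sigma; split => // beta /Cb; by rewrite add0r.
have [u [tau [P [D [Lu Eu tau0 [PT PP PK uP] [taut D0 dD]]]]]] := setup _ _ _ ab g1.
apply: (distance_growth A_skew A_hormander tau0 PT PP PK taut D0 dD).
move=> w beta Lw Ew; rewrite -lee_fin -dD -path_lengthE; last exact: L2vec_mul.
rewrite -Eu -(endp_projection A_skew A_hormander hfree Lu Lw PT PK
  (pencil_skew tau A_skew) uP (beta := beta)); last by rewrite Eu.
exact/cc_dist0_le/L2vec_mul.
Qed.
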